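(* Let $\bar U\colon \mathrm{Dens}(M)\to\mathbb{R}$ be a functional with smooth variational derivative $\frac{\delta \bar U}{\delta\rho}$, and consider the system for a time-dependent vector field $v$ on $M$ and a time-dependent density $\rho\in\mathrm{Dens}(M)$ $$\dot v+\nabla_v v+\nabla\frac{\delta\bar U}{\delta\rho}=0,\qquad \dot\rho+\operatorname{div}(\rho v)=0 .$$ The gradient fields $v=\nabla\theta$ form an invariant set of solutions of this system. Expressed in $\theta$ and $\rho$, these solutions fulfill the Hamilton–Jacobi equations $$\dot\theta+\tfrac12|\nabla\theta|^2=-\frac{\delta\bar U}{\delta\rho},\qquad \dot\rho+\operatorname{div}(\rho\nabla\theta)=0 .$$
   Context: $M$ is a compact connected oriented Riemannian manifold (without boundary) with metric $\mathsf g$, $|v|^2=\mathsf g(v,v)$, $\nabla$ denotes both the gradient and the Levi-Civita covariant derivative, and $\mu$ is the Riemannian volume form, normalized by $\int_M\mu=1$. $\mathrm{Dens}(M)$ is the space of smooth functions $\rho>0$ on $M$ with $\int_M\rho\mu=1$. The variational derivative $\frac{\delta\bar U}{\delta\rho}\in C^\infty(M)$ is defined by $\frac{d}{d\epsilon}|_{\epsilon=0}\bar U(\rho+\epsilon\dot\rho)=\int_M\frac{\delta\bar U}{\delta\rho}\dot\rho\,\mu$ for $\dot\rho$ of zero mean (so it is determined up to a constant). The function $\theta$ is determined by $v=\nabla\theta$ only up to an additive function of time. All objects are smooth. *)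

(* Defs.v *)
From HB Require Import structures.
From mathcomp Require Import all_boot all_order all_algebra.
From mathcomp Require Import all_classical all_reals all_analysis.

Set Implicit Arguments.
Unset Strict Implicit.
Unset Printing Implicit Defensive.
Import Order.TTheory GRing.Theory Num.Theory.
Import numFieldNormedType.Exports.

Local Open Scope classical_set_scope.
Local Open Scope ring_scope.

(* C^k on an open set D, by iterated directional derivatives; when V has finite
   dimension this is the usual notion. *)
Fixpoint Ck (R : realType) (V W : normedModType R) (k : nat)
    (D : set V) (f : V -> W) : Prop :=
  (forall x, D x -> {for x, continuous f}) /\
  match k with
  | 0%N => True
  | k'.+1 => forall u : V,
      (forall x, D x -> derivable f x u) /\ Ck k' D (fun x => 'D_u f x)
  end.

Definition smooth_on (R : realType) (V W : normedModType R)
    (D : set V) (f : V -> W) : Prop := forall k, Ck k D f.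

Record chart (R : realType) (n : nat) (T : topologicalType) := Chart {
  chart_dom : set T;
  chart_map : T -> 'rV[R]_n;
  chart_inv : 'rV[R]_n -> T;
  chart_dom_open : open chart_dom;
  chart_img_open : open (chart_map @` chart_dom);
  chart_mapK : forall p, chart_dom p -> chart_inv (chart_map p) = p;
  chart_map_continuous :
    forall p, chart_dom p -> {for p, continuous chart_map};
  chart_inv_continuous :
    forall p, chart_dom p -> {for chart_map p, continuous chart_inv} }.

(* Second countability is not required: it is automatic for the compact
   manifolds considered here. The base point only records nonemptiness. *)
Record oriented_manifold (R : realType) (n : nat) := OrientedManifold {
  point_of :> ptopologicalType;
  manifold_hausdorff : hausdorff_space point_of;
  chart_index : Type;
  atlas : chart_index -> chart R n point_of;
  atlas_cover : forall p, exists i, chart_dom (atlas i) p;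
  atlas_smooth : forall i j,
    smooth_on (chart_map (atlas i) @`
                 (chart_dom (atlas i) `&` chart_dom (atlas j)))
      (chart_map (atlas j) \o chart_inv (atlas i));
  atlas_oriented : forall i j p,
    chart_dom (atlas i) p -> chart_dom (atlas j) p ->
    0 < \det ('J (chart_map (atlas j) \o chart_inv (atlas i))
                 (chart_map (atlas i) p)) }.

Section Calculus.
Context {R : realType} {n : nat} (M : oriented_manifold R n).

Definition dom (i : chart_index M) : set M := chart_dom (atlas i).
Definition coord (i : chart_index M) : M -> 'rV[R]_n := chart_map (atlas i).
Definition param (i : chart_index M) : 'rV[R]_n -> M := chart_inv (atlas i).

(* Rows are indexed by the coordinates of chart i, columns by those of chart j,
   so that components (as row vectors) transform by right multiplication. *)
Definition transition_jacobian (i j : chart_index M) (p : M) : 'M[R]_n :=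
  'J (coord j \o param i) (coord i p).

Definition partial (i : chart_index M) (a : 'I_n) (f : M -> R) (p : M) : R :=
  'D_(delta_mx 0 a) (f \o param i : 'rV[R]_n -> R) (coord i p).

(* Tensor fields are given by their components in every chart of the atlas;
   the values of F i outside the domain of chart i are irrelevant. *)
Definition smooth_comp (W : normedModType R) (F : chart_index M -> M -> W) :=
  forall i, smooth_on (coord i @` dom i) (F i \o param i).

Definition smooth_fun (f : M -> R) := smooth_comp (fun _ => f : M -> R^o).

(* Joint smoothness in time and space on I x M. *)
Definition smooth_comp_on (W : normedModType R) (I : set R)
    (F : R -> chart_index M -> M -> W) :=
  forall i, smooth_on ((I `*` (coord i @` dom i)) : set (R^o * 'rV[R]_n)%type)
    (fun z : (R^o * 'rV[R]_n)%type => F z.1 i (param i z.2)).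

Definition smooth_fun_on (I : set R) (f : R -> M -> R) :=
  smooth_comp_on I (fun t _ => f t : M -> R^o).

Definition vector_field (X : chart_index M -> M -> 'rV[R]_n) :=
  forall i j p, dom i p -> dom j p ->
    X j p = X i p *m transition_jacobian i j p.

Record riemannian_metric := RiemannianMetric {
  metric_mx :> chart_index M -> M -> 'M[R]_n;
  metric_smooth : smooth_comp metric_mx;
  metric_tensor : forall i j p, dom i p -> dom j p ->
    metric_mx i p = transition_jacobian i j p *m metric_mx j p
                      *m (transition_jacobian i j p)^T;
  metric_sym : forall i p, dom i p -> (metric_mx i p)^T = metric_mx i p;
  metric_pos : forall i p (x : 'rV[R]_n), dom i p -> x != 0 ->
    0 < (x *m metric_mx i p *m x^T) 0 0 }.

Variable g : riemannian_metric.
Implicit Types X Y : chart_index M -> M -> 'rV[R]_n.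

Definition sqnorm X (i : chart_index M) (p : M) : R :=
  (X i p *m g i p *m (X i p)^T) 0 0.

Definition grad (f : M -> R) (i : chart_index M) (p : M) : 'rV[R]_n :=
  (\row_a partial i a f p) *m invmx (g i p).

(* Gamma^c_{ab}, the Christoffel symbols of the Levi-Civita connection *)
Definition christoffel (i : chart_index M) (p : M) (c a b : 'I_n) : R :=
  2^-1 * \sum_d invmx (g i p) c d *
    (partial i a (fun q => g i q b d) p + partial i b (fun q => g i q a d) p
       - partial i d (fun q => g i q a b) p).

(* nabla_X Y for the Levi-Civita connection *)
Definition nabla X Y (i : chart_index M) (p : M) : 'rV[R]_n :=
  \row_c (\sum_a X i p 0 a * partial i a (fun q => Y i q 0 c) p
          + \sum_a \sum_b christoffel i p c a b * X i p 0 a * Y i p 0 b).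

Definition sqrt_det (i : chart_index M) (p : M) : R := Num.sqrt (\det (g i p)).

Definition divergence X (i : chart_index M) (p : M) : R :=
  (sqrt_det i p)^-1 *
    \sum_a partial i a (fun q => sqrt_det i q * X i q 0 a) p.

Definition is_gradient X :=
  exists2 f : M -> R, smooth_fun f &
    forall i p, dom i p -> X i p = grad f i p.

End Calculus.

(* Lebesgue integral over R^n of a nonnegative Borel function, as an iterated
   one-dimensional integral (Tonelli) *)
Fixpoint integral_rV (R : realType) (n : nat) :
    ('rV[R]_n -> \bar R) -> \bar R :=
  match n with
  | 0%N => fun f => f 0
  | m.+1 => fun f => (\int[@lebesgue_measure R]_(x in [set: R])
      integral_rV (fun y : 'rV[R]_m => f (row_mx (x%:M : 'rV[R]_1) y)))%E
  end.

Definition borel (T : ptopologicalType) := g_sigma_algebraType (@open T).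

Section Densities.
Context {R : realType} {n : nat} {M : oriented_manifold R n}.

(* mu is the measure of the Riemannian volume form sqrt(det g) dx^1...dx^n,
   rescaled by a constant c so that M has total mass 1. *)
Definition normalized_volume (g : riemannian_metric M)
    (mu : probability (borel M) R) :=
  exists2 c : R, 0 < c & forall i (A : set (borel M)),
    measurable A -> A `<=` dom i ->
    mu A = (c%:E * integral_rV (fun x : 'rV[R]_n =>
      (\1_(coord i @` A) x * sqrt_det g i (param i x))%:E))%E.

Variable mu : probability (borel M) R.

Definition Dens : set (M -> R) :=
  [set rho | [/\ smooth_fun rho, forall p, 0 < rho p
                & \int[mu]_(p in [set: borel M]) rho p = 1]].

(* U and dU are total functions, but only their values on Dens matter. *)
Definition variational_derivative (U : (M -> R) -> R)
    (dU : (M -> R) -> (M -> R)) :=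
  forall rho, Dens rho -> smooth_fun (dU rho) /\
    forall sigma : M -> R, smooth_fun sigma ->
      \int[mu]_(p in [set: borel M]) sigma p = 0 ->
      is_derive (0 : R^o) (1 : R^o)
        (fun e : R^o => U (fun p => rho p + e * sigma p) : R^o)
        (\int[mu]_(p in [set: borel M]) (dU rho p * sigma p)).

Definition smooth_density_path (I : set R) (rho : R -> M -> R) :=
  (forall t, I t -> Dens (rho t)) /\ smooth_fun_on I rho.

(* Smoothness of dU as a map Dens -> C^oo(M) between (open subsets of affine)
   Frechet spaces: smooth curves are mapped to smooth curves. *)
Definition smooth_on_densities (dU : (M -> R) -> (M -> R)) :=
  forall (I : set R) (rho : R -> M -> R), open I -> is_interval I ->
    smooth_density_path I rho -> smooth_fun_on I (fun t => dU (rho t)).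

Variables (g : riemannian_metric M) (dU : (M -> R) -> (M -> R)).

Definition fluid_solution (I : set R)
    (v : R -> chart_index M -> M -> 'rV[R]_n) (rho : R -> M -> R) :=
  [/\ forall t, I t -> vector_field (v t), smooth_comp_on I v,
      smooth_density_path I rho
    & forall t i p, I t -> dom i p ->
        derive1 (fun s => v s i p) t + nabla g (v t) (v t) i p
          + grad g (dU (rho t)) i p = 0 /\
        derive1 (fun s => rho s p : R^o) t
          + divergence g (fun j q => rho t q *: v t j q) i p = 0].

Definition hamilton_jacobi_solution (I : set R)
    (theta rho : R -> M -> R) :=
  [/\ smooth_fun_on I theta, smooth_density_path I rho
    & forall t i p, I t -> dom i p ->
        derive1 (fun s => theta s p : R^o) t
          + 2^-1 * sqnorm g (grad g (theta t)) i p = - dU (rho t) p /\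
        derive1 (fun s => rho s p : R^o) t
          + divergence g (fun j q => rho t q *: grad g (theta t) j q) i p = 0].

Definition potential_on (I : set R)
    (v : R -> chart_index M -> M -> 'rV[R]_n) (theta : R -> M -> R) :=
  smooth_fun_on I theta /\
  forall t i p, I t -> dom i p -> v t i p = grad g (theta t) i p.

End Densities.

(* Main.v *)
Require Import Defs.
From HB Require Import structures.
From mathcomp Require Import all_boot all_order all_algebra.
From mathcomp Require Import all_classical all_reals all_analysis.
From mathcomp Require Import ring lra.
Import Order.TTheory GRing.Theory Num.Theory.
Import numFieldNormedType.Exports.
Local Open Scope classical_set_scope.
Local Open Scope ring_scope.

Set Implicit Arguments.
Unset Strict Implicit.
Unset Printing Implicit Defensive.

(** Let [alpha = g(v, -)] and [beta = |v|^2/2 + dU(rho)]. Lowering the index in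
    the momentum equation gives [d_t alpha = - i_v (d alpha) - d beta]. Given a potential [f0] at time [t0], define
    [theta_t = f0 - \int_t0^t beta_s ds]; then the defect
    [alpha - d theta] vanishes at [t0] and has time derivative [- i_v (d alpha)].
    The vorticity [omega = d alpha] satisfies a linear transport equation
    [d_t omega + v . omega' = B omega], so it stays zero near a point where it
    vanishes initially, by a maximum principle on a shrinking cone in a chart.
    Hence the set of times with [v_t = grad theta_t] is open in [I] (uniformly
    over the compact [M]) and closed, so it is [I], and [theta] solves the
    Hamilton-Jacobi equation by construction. Working with the local statement
    "[v_t] is a gradient" rather than with [omega] globally, only the first-order
    chain rule for gradients under chart changes is needed. Two potentials of
    the same gradient field differ by a constant on the connected [M]. *)

(** * Calculus of [Ck] functions *)

(** The lowered equation rests on the identity $g(\nabla_v v,-) = i_v d\alpha + \frac12 d|v|^2$; the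
    exact part joins [dU(rho)] in [beta]. The vorticity is followed without using the flow of [v]: a
    weight that vanishes on the boundary of the shrinking cone confines the estimate to one chart,
    and running it in both directions of time reaches times before and after [t0]. Second
    derivatives therefore occur only inside a single chart. Smoothness means iterated directional
    derivatives on open sets, so linearity in the direction, symmetry of mixed derivatives and
    Frechet differentiability are all extracted from the mean value theorem. Spacetime in a chart is
    the product [R^o * 'rV[R]_n], where time and space derivatives are directional derivatives of
    the same kind. The potential has to be jointly smooth in time and space, which is why time
    integrals depending on parameters are differentiated to all orders. *)

Section CkBasics.
Context {R : realType} {V : normedModType R}.
Implicit Types (D : set V) (k : nat).

Lemma Ck_continuous (W : normedModType R) k D (f : V -> W) x :
  Ck k D f -> D x -> {for x, continuous f}.
Proof. by case: k => [|k] [fc _]; exact: fc. Qed.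

Lemma Ck_derivable (W : normedModType R) k D (f : V -> W) x u :
  Ck k.+1 D f -> D x -> derivable f x u.
Proof. by case=> _ /(_ u)[fd _]; exact: fd. Qed.

Lemma Ck_derive (W : normedModType R) k D (f : V -> W) u :
  Ck k.+1 D f -> Ck k D ('D_u f).
Proof. by case=> _ /(_ u)[]. Qed.

Lemma Ck_pred (W : normedModType R) k D (f : V -> W) : Ck k.+1 D f -> Ck k D f.
Proof.
elim: k f => [f|k IH f] [fc fd]; split=> // u.
by have [fdu /IH fDu] := fd u.
Qed.

Lemma Ck_sub (W : normedModType R) k D D' (f : V -> W) :
  D' `<=` D -> Ck k D f -> Ck k D' f.
Proof.
move=> DD'; elim: k f => [f|k IH f] [fc fd]; split=> //; try by move=> x /DD'/fc.
by move=> u; have [fdu /IH fDu] := fd u; split=> // x /DD' /fdu.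
Qed.

(** Openness of [D] turns agreement on [D] into agreement near each of its points, and this passes
    to every iterated directional derivative. *)
Lemma Ck_ext (W : normedModType R) k D (f g : V -> W) : open D ->
  (forall x, D x -> f x = g x) -> Ck k D f -> Ck k D g.
Proof.
move=> oD; elim: k f g => [|k IH] f g fg [fc fd].
all: have fgn x : D x -> \near x, f x = g x by
  move=> Dx; apply: filterS (open_nbhs_nbhs (conj oD Dx)) => y /fg.
all: have gc x : D x -> {for x, continuous g} by
  move=> Dx; rewrite /prop_for/continuous_at -(fg x Dx);
  exact: cvg_trans (near_eq_cvg (fgn x Dx)) (fc x Dx).
all: split => // u.
have [fdu fDu] := fd u; split.
  by move=> x Dx; apply: near_eq_derivable (fdu _ Dx); exact: fgn.
by apply: IH fDu => x Dx; apply: near_eq_derive; exact: fgn.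
Qed.

Lemma Ck_cst (W : normedModType R) k D (w : W) : Ck k D (cst w : V -> W).
Proof.
elim: k w => [|k IH] w; split=> //; try by move=> x _; exact: cst_continuous.
move=> u; split=> [x _|]; first exact: derivable_cst.
rewrite (_ : (fun _ => _) = cst 0); first exact: IH.
by apply/funext => x; rewrite derive_cst.
Qed.

Lemma CkD (W : normedModType R) k D (f g : V -> W) : open D ->
  Ck k D f -> Ck k D g -> Ck k D (fun x => f x + g x).
Proof.
move=> oD; elim: k f g => [|k IH] f g [fc fd] [gc gd].
  by split=> // x Dx; apply: cvgD; [exact: fc|exact: gc].
split=> [x Dx|u]; first by apply: cvgD; [exact: fc|exact: gc].
have [fdu fDu] := fd u; have [gdu gDu] := gd u.
split=> [x Dx|]; first by apply: derivableD; [exact: fdu|exact: gdu].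
apply: (Ck_ext oD _ (IH _ _ fDu gDu)) => x Dx.
by rewrite deriveD//; [exact: fdu|exact: gdu].
Qed.

Lemma CkN (W : normedModType R) k D (f : V -> W) : open D ->
  Ck k D f -> Ck k D (fun x => - f x).
Proof.
move=> oD; elim: k f => [|k IH] f [fc fd].
  by split=> // x Dx; apply: cvgN; exact: fc.
split=> [x Dx|u]; first by apply: cvgN; exact: fc.
have [fdu fDu] := fd u.
split=> [x Dx|]; first by apply: derivableN; exact: fdu.
apply: (Ck_ext oD _ (IH _ fDu)) => x Dx.
by rewrite deriveN//; exact: fdu.
Qed.

Lemma CkB (W : normedModType R) k D (f g : V -> W) : open D ->
  Ck k D f -> Ck k D g -> Ck k D (fun x => f x - g x).
Proof. by move=> oD fk gk; apply: CkD => //; exact: CkN. Qed.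

Lemma CkM k D (f g : V -> R^o) : open D ->
  Ck k D f -> Ck k D g -> Ck k D (fun x => f x * g x : R^o).
Proof.
move=> oD; elim: k f g => [|k IH] f g fk gk.
  split=> // x Dx.
  by apply: cvgM; [exact: (Ck_continuous fk Dx)|exact: (Ck_continuous gk Dx)].
split=> [x Dx|u].
  by apply: cvgM; [exact: (Ck_continuous fk Dx)|exact: (Ck_continuous gk Dx)].
have fd x : D x -> derivable f x u by exact: (Ck_derivable fk).
have gd x : D x -> derivable g x u by exact: (Ck_derivable gk).
split=> [x Dx|]; first by apply: derivableM; [exact: fd|exact: gd].
have H := CkD oD (IH _ _ (Ck_pred fk) (Ck_derive u gk))
  (IH _ _ (Ck_pred gk) (Ck_derive u fk)).
apply: (Ck_ext oD _ H) => x Dx.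
by rewrite (@deriveM _ _ f g)//; [exact: fd|exact: gd].
Qed.

Lemma Ck_sum (W : normedModType R) k D (J : Type) (r : seq J) (P : pred J)
    (f : J -> V -> W) : open D ->
  (forall j, Ck k D (f j)) -> Ck k D (fun x => \sum_(j <- r | P j) f j x).
Proof.
move=> oD fk; elim: r => [|j r IH].
  by apply: (Ck_ext oD _ (Ck_cst k D 0)) => x _; rewrite big_nil.
case Pj : (P j); last first.
  by apply: (Ck_ext oD _ IH) => x _; rewrite big_cons Pj.
by apply: (Ck_ext oD _ (CkD oD (fk j) IH)) => x _; rewrite big_cons Pj.
Qed.

Lemma Ck_mx k D m n (F : V -> 'M[R]_(m, n)) i j : open D ->
  Ck k D F -> Ck k D (fun x => F x i j : R^o).
Proof.
move=> oD; elim: k F => [|k IH] F Fk.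
  split=> // x Dx.
  exact: (continuous_comp (Ck_continuous Fk Dx) (@coord_continuous _ _ _ i j _)).
split=> [x Dx|u].
  exact: (continuous_comp (Ck_continuous Fk Dx) (@coord_continuous _ _ _ i j _)).
split=> [x Dx|].
  have /derivable_mxP Fd : derivable F x u := Ck_derivable Fk Dx; exact: Fd.
apply: (Ck_ext oD _ (IH _ (Ck_derive u Fk))) => x Dx.
by rewrite derive_mx ?mxE//; exact: (Ck_derivable Fk Dx).
Qed.

End CkBasics.

(** * Precomposition with affine maps *)

Section Affine.
Context {R : realType} {V V' W : normedModType R}.
Variables (L : V' -> V) (l : V' -> V).
Hypothesis L_affine : forall (h : R) u x, L (h *: u + x) = h *: l u + L x.

(** The difference quotient of [f \o L] along [u] is literally that of [f] along [l u], so no chain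
    rule and no differentiability of [f] is involved. *)
Lemma derivable_affine (f : V -> W) u x :
  derivable f (L x) (l u) -> derivable (f \o L) x u.
Proof.
rewrite /derivable; set g1 := fun h => _; set g2 := fun h => _.
suff -> : g2 = g1 by [].
by apply/funext => h; rewrite /g1 /g2 /= L_affine.
Qed.

Lemma derive_affine (f : V -> W) u x : 'D_u (f \o L) x = 'D_(l u) f (L x).
Proof.
rewrite /derive; set g1 := fun h => _; set g2 := fun h => _.
suff -> : g1 = g2 by [].
by apply/funext => h; rewrite /g1 /g2 /= L_affine.
Qed.

Lemma Ck_affine k D (f : V -> W) : continuous L ->
  Ck k D f -> Ck k (L @^-1` D) (f \o L).
Proof.
move=> cL; elim: k f => [|k IH] f fk.
  split=> // x Dx; apply: continuous_comp; first exact: cL.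
  exact: (Ck_continuous fk Dx).
split=> [x Dx|u].
  by apply: continuous_comp; [exact: cL|exact: (Ck_continuous fk Dx)].
split=> [x Dx|]; first by apply: derivable_affine; exact: (Ck_derivable fk Dx).
rewrite (_ : (fun x => _) = 'D_(l u) f \o L); first by apply: IH; exact: Ck_derive.
by apply/funext => x; rewrite derive_affine.
Qed.

End Affine.

(** * Mean values along segments and linearity in the direction *)

Section Directional.
Context {R : realType} {V : normedModType R}.

Lemma near_plane (P : set V) (x u w : V) : nbhs x P ->
  exists2 d : R, 0 < d &
    forall a b, `|a| < d -> `|b| < d -> P (a *: u + (b *: w + x)).
Proof.
move=> /nbhs_ballP[e /= e0 eP].
have c0 : 0 < `|u| + `|w| + 1 by rewrite ltr_wpDl// addr_ge0.
exists (e / (`|u| + `|w| + 1)); first by rewrite divr_gt0.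
move=> a b ad bd; apply: eP; rewrite -ball_normE /=.
rewrite addrA opprD addrCA subrr addr0 normrN.
apply: (le_lt_trans (ler_normD _ _)); rewrite !normrZ.
apply: (@le_lt_trans _ _ (e / (`|u| + `|w| + 1) * (`|u| + `|w|))).
  by rewrite mulrDr lerD// ler_wpM2r// ltW.
by rewrite -mulrA gtr_pMr// mulrC ltr_pdivrMr// mul1r ltrDl.
Qed.

Lemma line_affine (w x : V) (h u t : R) :
  (h *: u + t) *: w + x = h *: (u *: w) + (t *: w + x).
Proof. by rewrite scalerDl scalerA addrA. Qed.

Lemma derivable_line (W : normedModType R) (f : V -> W) (w x : V) (t : R^o) :
  derivable f (t *: w + x) w -> derivable (fun s : R^o => f (s *: w + x)) t 1.
Proof.
move=> fd; apply: (derivable_affine (L := fun s : R^o => s *: w + x)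
  (l := fun s : R^o => s *: w)); first exact: line_affine.
by rewrite scale1r.
Qed.

Lemma derive_line (W : normedModType R) (f : V -> W) (w x : V) (t : R^o) :
  'D_1 (fun s : R^o => f (s *: w + x)) t = 'D_w f (t *: w + x).
Proof.
rewrite (derive_affine (L := fun s : R^o => s *: w + x)
  (l := fun s : R^o => s *: w)) ?scale1r//; exact: line_affine.
Qed.

Lemma MVT_direction (f : V -> R^o) (w x : V) :
  (forall t : R, 0 <= t <= 1 -> derivable f (t *: w + x) w) ->
  exists2 t : R, 0 < t < 1 & f (w + x) - f x = 'D_w f (t *: w + x).
Proof.
move=> fd; pose phi (t : R^o) : R^o := f (t *: w + x).
have phid t : 0 <= t <= 1 -> derivable phi t 1.
  by move=> /fd; exact: derivable_line.
have [|||t t01 E] := @MVT R phi (fun t => 'D_w f (t *: w + x)) 0 1.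
- exact: ltr01.
- move=> t; rewrite in_itv /= => /andP[t0 t1].
  have := phid t; rewrite (ltW t0) (ltW t1) => /(_ isT)/derivableP.
  by rewrite derive_line.
- apply: derivable_within_continuous => t; rewrite in_itv /=; exact: phid.
exists t => //; move: E.
by rewrite /phi scale1r scale0r add0r subr0 mulr1.
Qed.

(** On the line through [x] in direction [u], derivability is differentiability, so the parameter
    may be rescaled by the chain rule. Nothing is asked of [f] off that line, and [h = 0] is
    covered. *)
Lemma is_derive_dirZ (W : normedModType R) (f : V -> W) (x u : V) (h : R) :
  derivable f x u -> is_derive x (h *: u) f (h *: 'D_u f x).
Proof.
move=> fd; pose phi (t : R^o) := f (t *: u + x).
have phid : derivable phi 0 1 by apply: derivable_line; rewrite scale0r add0r.
have dphi : differentiable phi (0 : R^o) by exact/derivable1_diffP.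
have E : (fun t : R^o => f (t *: (h *: u) + x)) = phi \o (fun t : R^o => h *: t : R^o).
  by apply/funext => t; rewrite /phi /= scalerA mulrC.
have dm : is_diff (0 : R^o) (fun t : R^o => h *: t : R^o) ( *:%R h).
  exact: is_diff_scaler.
have dc : differentiable (phi \o (fun t : R^o => h *: t : R^o)) (0 : R^o).
  by apply: differentiable_comp; rewrite ?scaler0//; exact: ex_diff.
have D1 : derivable f x (h *: u).
  by apply/derivable1P; rewrite E; exact/derivable1_diffP.
apply: DeriveDef => //.
have := @derive_line W f (h *: u) x 0; rewrite scale0r add0r => <-.
rewrite E deriveE// diff_comp//=; last by rewrite scaler0.
rewrite scaler0 diff_val linearZ /= -deriveE//; congr (_ *: _).
by rewrite derive_line scale0r add0r.
Qed.

(** Directional derivatives alone need not be additive. The increment is split into a leg along [u]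
    and a leg along [w]; on the second leg the mean value theorem and the continuity of ['D_w f] at
    [x] give the limit. *)
Lemma is_derive_dirD (D : set V) (f : V -> R^o) (x u w : V) : open D -> D x ->
  (forall y, D y -> derivable f y w) -> derivable f x u ->
  {for x, continuous ('D_w f)} ->
  is_derive x (u + w) f ('D_u f x + 'D_w f x).
Proof.
move=> oD Dx fw fu cw.
have nD : \near x, D x by exact: (open_nbhs_nbhs (conj oD Dx)).
suff H : (fun h => h^-1 *: ((f \o shift x) (h *: (u + w)) - f x)) @ 0^' -->
    'D_u f x + 'D_w f x.
  by apply: DeriveDef; [apply/cvg_ex; eexists; exact: H|exact: cvg_lim H].
rewrite (_ : (fun h => _) = (fun h => h^-1 *: ((f \o shift x) (h *: u) - f x))
   \+ (fun h => h^-1 *: (f (h *: w + (h *: u + x)) - f (h *: u + x)))); last first.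
  apply/funext => h /=; rewrite -scalerDr; congr (_ *: _).
  rewrite scalerDr [X in X + x]addrC -addrA.
  by rewrite [RHS]addrC [RHS]addrA subrK.
apply: cvgD; first exact: fu.
apply/cvgrPdist_le => e e0.
have nP : \forall y \near x, D y /\ `|'D_w f x - 'D_w f y| <= e.
  apply: filterI => //; by move/cvgrPdist_le: cw; apply.
have [d d0 dP] := near_plane u w nP.
near=> h.
have h0 : h != 0 by near: h; exact: nbhs_dnbhs_neq.
have hd : `|h| < d by near: h; exact: dnbhs0_lt.
have hD t : 0 <= t <= 1 ->
    D (t *: (h *: w) + (h *: u + x)) /\
    `|'D_w f x - 'D_w f (t *: (h *: w) + (h *: u + x))| <= e.
  move=> /andP[t0 t1]; rewrite scalerA addrCA; apply: dP => //.
  by rewrite normrM (le_lt_trans _ hd)// ger0_norm// ler_piMl.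
have [t|t t01 ->] := @MVT_direction f (h *: w) (h *: u + x).
  move=> /hD[Dt _]; exact: (ex_derive (is_derive := is_derive_dirZ h (fw _ Dt))).
have t01' : 0 <= t <= 1 by case/andP: t01 => t0 t1; rewrite !ltW.
have [Dt fe] := hD t t01'.
rewrite (derive_val (is_derive := is_derive_dirZ h (fw _ Dt))).
by rewrite [X in _ - X]scalerA mulVf// scale1r.
Unshelve. all: by end_near. Qed.

End Directional.

(** * Combinations of directions and symmetry of second derivatives *)

Section C1.
Context {R : realType} {V : normedModType R}.

Lemma Ck_derive_dirD k (D : set V) (f : V -> R^o) x u w : open D ->
  Ck k.+1 D f -> D x -> 'D_(u + w) f x = 'D_u f x + 'D_w f x.
Proof.
move=> oD fk Dx; apply: derive_val; apply: (is_derive_dirD oD Dx).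
- by move=> y; exact: (Ck_derivable fk).
- exact: (Ck_derivable fk).
- exact: (Ck_continuous (Ck_derive w fk)).
Qed.

Lemma Ck_derive_dirZ k (W : normedModType R) (D : set V) (f : V -> W) x u (a : R) :
  Ck k.+1 D f -> D x -> 'D_(a *: u) f x = a *: 'D_u f x.
Proof.
by move=> fk Dx; apply: derive_val; apply: is_derive_dirZ; exact: (Ck_derivable fk).
Qed.

Lemma Ck_derive_dir_sum k (D : set V) (f : V -> R^o) x (J : Type) (r : seq J)
    (a : J -> R) (e : J -> V) : open D -> Ck k.+1 D f -> D x ->
  'D_(\sum_(j <- r) a j *: e j) f x = \sum_(j <- r) a j * 'D_(e j) f x.
Proof.
move=> oD fk Dx; elim: r => [|j r IH]; first by rewrite !big_nil derive0.
by rewrite !big_cons (Ck_derive_dirD _ _ oD fk Dx) IH (Ck_derive_dirZ _ _ fk Dx).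
Qed.

Let second_difference (f : V -> R^o) (x u w : V) (h : R) : R :=
  f (h *: w + (h *: u + x)) - f (h *: u + x) - (f (h *: w + x) - f x).

(** The second difference is the increment along [h *: u] of [g], itself the increment of [f] along
    [h *: w]. One mean value step for [g] produces ['D_u f] at two points, a second one produces
    ['D_w ('D_u f)] at a point tending to [x], where it is continuous. *)
Let second_difference_cvg k (D : set V) (f : V -> R^o) x u w : open D ->
  Ck k.+2 D f -> D x ->
  (fun h => h^-1 * (h^-1 * second_difference f x u w h)) @ 0^' -->
    'D_w ('D_u f) x.
Proof.
move=> oD fk Dx; have nD : \near x, D x by exact: (open_nbhs_nbhs (conj oD Dx)).
apply/cvgrPdist_le => e e0.
have nP : \forall y \near x, D y /\ `|'D_w ('D_u f) x - 'D_w ('D_u f) y| <= e.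
  apply: filterI => //; move: e e0; apply/cvgrPdist_le.
  exact: (Ck_continuous (Ck_derive w (Ck_derive u fk))).
have [d d0 dP] := near_plane w u nP.
near=> h.
have h0 : h != 0 by near: h; exact: nbhs_dnbhs_neq.
have hd : `|h| < d by near: h; exact: dnbhs0_lt.
have small t : 0 <= t <= 1 -> `|t * h| < d.
  move=> /andP[t0 t1].
  by rewrite normrM (le_lt_trans _ hd)// ger0_norm// ler_piMl.
have in01 t : 0 < t < 1 -> 0 <= t <= 1 by case/andP=> t0 t1; rewrite !ltW.
have i0 : 0 <= (0 : R) <= 1 by rewrite lexx ler01.
have i1 : 0 <= (1 : R) <= 1 by rewrite lexx ler01.
have DD s t : 0 <= s <= 1 -> 0 <= t <= 1 ->
    D (s *: (h *: w) + (t *: (h *: u) + x)).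
  by move=> /small s1 /small t1; rewrite !scalerA; have [] := dP _ _ s1 t1.
have D0 t : 0 <= t <= 1 -> D (t *: (h *: u) + x).
  by move=> /(DD _ _ i0); rewrite scale0r add0r.
have D1 t : 0 <= t <= 1 -> D (h *: w + (t *: (h *: u) + x)).
  by move=> /(DD _ _ i1); rewrite scale1r.
have trans_affine (c : R) (a b : V) :
  h *: w + (c *: a + b) = c *: a + (h *: w + b) by rewrite addrCA.
pose g : V -> R^o := (f \o (fun y => h *: w + y)) - f.
have gd y a : D y -> D (h *: w + y) ->
    is_derive y a g ('D_a f (h *: w + y) - 'D_a f y).
  move=> Dy Dhy; apply: is_deriveB.
    apply: DeriveDef; last by rewrite (derive_affine trans_affine).
    by apply: (derivable_affine trans_affine); exact: (Ck_derivable fk).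
  by apply: derivableP; exact: (Ck_derivable fk).
have [t t01|t /in01 t01 Eg] := @MVT_direction R V g (h *: u) x.
  exact: (ex_derive (is_derive := gd _ (h *: u) (D0 t t01) (D1 t t01))).
set y := t *: (h *: u) + x in Eg.
have [s s01|s /in01 s01 Ef] := @MVT_direction R V ('D_u f) (h *: w) y.
  exact: (Ck_derivable (Ck_derive u fk) (DD s t s01 t01)).
have -> : second_difference f x u w h =
    h * (h * 'D_w ('D_u f) (s *: (h *: w) + y)).
  transitivity (g (h *: u + x) - g x); first by [].
  rewrite Eg (derive_val (is_derive := gd _ (h *: u) (D0 t t01) (D1 t t01))).
  rewrite (Ck_derive_dirZ _ _ fk (D0 t t01)) (Ck_derive_dirZ _ _ fk (D1 t t01)).
  rewrite -/y -scalerBr Ef.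
  by rewrite (Ck_derive_dirZ _ _ (Ck_derive u fk) (DD s t s01 t01)).
rewrite !mulKf//.
by have [] := dP _ _ (small s s01) (small t t01); rewrite -!scalerA.
Unshelve. all: by end_near. Qed.

(** The second difference is unchanged when [u] and [w] are exchanged, so its two limits
    coincide. *)
Lemma Ck_derive_comm k (D : set V) (f : V -> R^o) x u w : open D ->
  Ck k.+2 D f -> D x -> 'D_w ('D_u f) x = 'D_u ('D_w f) x.
Proof.
move=> oD fk Dx; have cuw := @second_difference_cvg k D f x u w oD fk Dx.
have sC : second_difference f x u w = second_difference f x w u.
  apply/funext => h; rewrite /second_difference [h *: w + (_ + _)]addrCA.
  by rewrite !opprB addrACA [RHS]addrACA; congr (_ + _); exact: addrC.
rewrite sC in cuw; exact: norm_cvg_unique cuw (second_difference_cvg oD fk Dx).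
Qed.

End C1.

(** * Frechet differentiability in finite dimension *)

Lemma differentiable_approx (R : realType) (V W : normedModType R) (f : V -> W)
    (L : {linear V -> W}) (x : V) : continuous L ->
  (forall e : R, 0 < e ->
    \forall h \near (0 : V), `|f (h + x) - (f x + L h)| <= e * `|h|) ->
  differentiable f x.
Proof.
move=> cL fL; have H : f \o shift x = cst (f x) + L +o_ (0 : V) id.
  by apply/eqaddoP => e e0; exact: fL.
by apply/diff_locallyP; rewrite (diff_unique cL H).
Qed.

Section Frechet.
Context {R : realType} {n : nat}.

Lemma rV_entry_norm (u : 'rV[R]_n) j : `|u 0 j| <= `|u|.
Proof.
rewrite [leRHS]/Num.Def.normr/= mx_normrE.
exact: (le_bigmax _ (fun ij => `|u ij.1 ij.2|) (0, j)).
Qed.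

Lemma Ck_derive_rV k (D : set 'rV[R]_n) (f : 'rV[R]_n -> R^o) x u : open D ->
  Ck k.+1 D f -> D x ->
  'D_u f x = \sum_j u 0 j * 'D_(delta_mx 0 j) f x.
Proof.
by move=> oD fk Dx; rewrite {1}[u]row_sum_delta (Ck_derive_dir_sum _ _ _ oD fk Dx).
Qed.

(** Being a finite combination of the coordinates of [u], the map ['D_u f x] is linear and
    continuous in [u]; continuity of the partial derivatives makes it approximate the increment of
    [f] to first order. *)
Lemma Ck_differentiable k (D : set 'rV[R]_n) (f : 'rV[R]_n -> R^o) x : open D ->
  Ck k.+1 D f -> D x -> differentiable f x.
Proof.
move=> oD fk Dx; pose L (u : 'rV[R]_n) : R^o := 'D_u f x.
have linL : linear L.
  move=> a u w; rewrite /L (Ck_derive_dirD _ _ oD fk Dx).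
  by rewrite (Ck_derive_dirZ _ _ fk Dx).
pose LM := GRing.isLinear.Build _ _ _ _ L linL.
pose LL : {linear 'rV[R]_n -> R^o} := HB.pack L LM.
have LE u : L u = \sum_j u 0 j * 'D_(delta_mx 0 j) f x.
  by rewrite -(Ck_derive_rV _ oD fk Dx).
have cL : continuous LL.
  rewrite (_ : (LL : _ -> _) =
    (fun u : 'rV[R]_n => \sum_j u 0 j * 'D_(delta_mx 0 j) f x)); last exact/funext.
  move=> u; apply: (@Ck_continuous _ _ _ 0 setT) => //.
  apply: Ck_sum => [|j]; first exact: openT.
  apply: (CkM openT _ (Ck_cst _ _ _)); apply: (Ck_mx _ _ openT).
  by split=> // w _; exact: cvg_id.
apply: (differentiable_approx cL) => e e0.
(* Each of the [n] partial derivatives is allowed this share of [e]; taking [n.+1] keeps the divisor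
   nonzero when [n = 0]. *)
have e'0 : 0 < e / n.+1%:R by rewrite divr_gt0.
have nP : \forall y \near x, D y /\ (forall j : 'I_n,
    `|'D_(delta_mx 0 j) f y - 'D_(delta_mx 0 j) f x| <= e / n.+1%:R).
  apply: filterI; first exact: (open_nbhs_nbhs (conj oD Dx)).
  apply: (@filter_forall _ _ (fun (j : 'I_n) (y : 'rV[R]_n) =>
    `|'D_(delta_mx 0 j) f y - 'D_(delta_mx 0 j) f x| <= e / n.+1%:R) (nbhs x)) => j.
  have /cvgrPdist_le/(_ _ e'0) := Ck_continuous (Ck_derive (delta_mx 0 j) fk) Dx.
  by apply: filterS => y; rewrite distrC.
move: nP => /nbhs_ballP[d /= d0 dP].
apply/nbhs_ballP; exists d => //= h; rewrite -ball_normE /= sub0r normrN => hd.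
have tP t : 0 <= t <= 1 -> ball x d (t *: h + x).
  move=> /andP[t0 t1]; rewrite -ball_normE /= opprD addrCA subrr addr0 normrN.
  by rewrite normrZ (le_lt_trans _ hd)// ger0_norm// ler_piMl.
have [t /tP/dP[Dt _]|t /andP[/ltW t0 /ltW t1] E] := @MVT_direction R _ f h x.
  exact: (Ck_derivable fk Dt).
have [Dt Et] := dP _ (tP t (introT andP (conj t0 t1))).
rewrite opprD addrA E.
rewrite (Ck_derive_rV _ oD fk Dt) LE -sumrB.
apply: (le_trans (ler_norm_sum _ _ _)).
apply: (@le_trans _ _ (\sum_(j < n) `|h| * (e / n.+1%:R))).
  apply: ler_sum => j _; rewrite -mulrBr normrM.
  by apply: ler_pM => //; exact: rV_entry_norm.
rewrite sumr_const card_ord -[leLHS]mulr_natr -mulrA mulrC ler_wpM2r//.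
rewrite -mulrA ler_piMr ?(ltW e0)// mulrC ler_pdivrMr// mul1r ler_nat.
exact: leqnSn.
Qed.

Lemma Ck_differentiable_rV m k (D : set 'rV[R]_n) (f : 'rV[R]_n -> 'rV[R]_m) x :
  open D -> Ck k.+1 D f -> D x -> differentiable f x.
Proof.
move=> oD fk Dx.
rewrite (_ : f = \sum_(j < m) (fun y => f y 0 j *: delta_mx 0 j)); last first.
  by apply/funext => y; rewrite {1}[f y]row_sum_delta fct_sumE.
apply: differentiable_sum => j; apply: differentiableZl.
exact: (Ck_differentiable oD (Ck_mx 0 j oD fk)).
Qed.

End Frechet.

(** * Averages along time segments *)

HB.lock Definition int01 (R : realType) (f : R -> R) : R :=
  \int[@lebesgue_measure R]_(r in `[0%R, 1%R]) f r.

Section UnitIntegral.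
Context {R : realType}.
Implicit Types f g : R -> R.

Definition cont01 f := forall r : R, 0 <= r <= 1 -> {for r, continuous f}.

Lemma cont01_within f : cont01 f -> {within `[0, 1], continuous f}.
Proof.
move=> cf; apply: continuous_in_subspaceT => r; rewrite inE /= in_itv /=.
exact: cf.
Qed.

Lemma cont01_integrable f : cont01 f ->
  (@lebesgue_measure R).-integrable `[0%R, 1%R] (EFin \o f).
Proof.
move=> /cont01_within cf; apply: continuous_compact_integrable => //.
exact: segment_compact.
Qed.

Lemma int01D f g : cont01 f -> cont01 g ->
  int01 (fun r => f r + g r) = int01 f + int01 g.
Proof.
by move=> cf cg; rewrite int01.unlock; apply: RintegralD => //; exact: cont01_integrable.
Qed.

Lemma int01Z (a : R) f : cont01 f -> int01 (fun r => a * f r) = a * int01 f.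
Proof. by move=> cf; rewrite int01.unlock; apply: RintegralZl => //; exact: cont01_integrable. Qed.

Lemma cont01D f g : cont01 f -> cont01 g -> cont01 (fun r => f r + g r).
Proof. by move=> cf cg r r01; apply: cvgD; [exact: cf|exact: cg]. Qed.

Lemma cont01M f g : cont01 f -> cont01 g -> cont01 (fun r => f r * g r).
Proof. by move=> cf cg r r01; apply: cvgM; [exact: cf|exact: cg]. Qed.

Lemma cont01_cst (c : R) : cont01 (fun=> c).
Proof. by move=> r _; exact: cst_continuous. Qed.

Lemma eq_int01 f g : (forall r, 0 <= r <= 1 -> f r = g r) -> int01 f = int01 g.
Proof.
by move=> fg; rewrite int01.unlock; apply: eq_Rintegral => r; rewrite inE /= in_itv /=; exact: fg.
Qed.

Lemma int01_dist f g (e : R) : cont01 f -> cont01 g ->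
  (forall r, 0 <= r <= 1 -> `|f r - g r| <= e) -> `|int01 f - int01 g| <= e.
Proof.
move=> cf cg fg.
have cfg : cont01 (fun r => f r - g r).
  by move=> r r01; apply: cvgB; [exact: cf|exact: cg].
rewrite int01.unlock -RintegralB//; try exact: cont01_integrable.
apply: (le_trans (le_normr_Rintegral _ _)) => //.
  exact: cont01_integrable.
apply: (@le_trans _ _ (\int[@lebesgue_measure R]_(_ in `[0%R, 1%R]) e)).
  apply: le_Rintegral => //; try exact: (cont01_integrable (@cont01_cst e)).
  apply: (@cont01_integrable (fun r => `|f r - g r|)) => r r01.
  by apply: continuous_comp; [exact: cfg|exact: norm_continuous].
by rewrite Rintegral_cst//= lebesgue_measure_itv /= lte01 oppr0 adde0 mulr1.
Qed.

Lemma int01_derive (f df : R -> R) : cont01 df ->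
  (forall r : R, 0 <= r <= 1 -> is_derive (r : R^o) 1 (f : R^o -> R^o) (df r)) ->
  int01 df = f 1 - f 0.
Proof.
move=> cdf fdf; rewrite int01.unlock /Rintegral.
have in01 r : r \in `]0%R, 1%R[ -> 0 <= r <= 1.
  by rewrite in_itv /= => /andP[r0 r1]; rewrite !ltW.
have fc (r : R) : 0 <= r <= 1 -> {for r, continuous f}.
  move=> /fdf[fd _]; exact/differentiable_continuous/derivable1_diffP.
rewrite (@continuous_FTC2 _ df f)//.
- exact: cont01_within.
- split.
  + by move=> r /in01/fdf[].
  + by apply: cvg_at_right_filter; apply: fc; rewrite lexx ler01.
  + by apply: cvg_at_left_filter; apply: fc; rewrite lexx ler01.
- by move=> r /in01/fdf[fd]; rewrite derive1E.
Qed.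

End UnitIntegral.

Lemma nbhs_and_sub (R : realType) (U : normedModType R) (x : U) (P Q S : set U) :
  nbhs x P -> nbhs x Q -> (forall y, P y -> Q y -> S y) -> nbhs x S.
Proof. by move=> nP nQ PQS; apply: filterS2 nP nQ. Qed.

Lemma continuous_dist (R : realType) (U : normedModType R) (f : U -> R^o) (x : U) :
  (forall e : R, 0 < e -> nbhs x (fun y => `|f x - f y| <= e)) ->
  {for x, continuous f}.
Proof. by move=> H; apply/cvgrPdist_le => e /H. Qed.

(** * Parameter dependence of time averages *)

Section TimeAverage.
Context {R : realType} {V : normedModType R}.
Variable t0 : R.
Implicit Types (z w : (R^o * V)%type) (F : (R^o * V)%type -> R^o).

Definition tseg (r : R) z : (R^o * V)%type := (t0 + r * (z.1 - t0), z.2).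

(* [(z.1 - t0) * tavg 0 F z] is the integral of [F (-, z.2)] from [t0] to [z.1],
   rescaled to the fixed interval [0, 1]; the weights [r ^+ j] are those produced
   by differentiating in time. *)
Definition tavg (j : nat) F z : R^o := int01 (fun r => r ^+ j * F (tseg r z)).

Variable E : set (R^o * V)%type.
Hypothesis oE : open E.
Hypothesis segE : forall z r, E z -> 0 <= r <= 1 -> E (tseg r z).

Lemma tseg_shift r h w z :
  tseg r (h *: w + z) = h *: ((r * w.1, w.2) : (R^o * V)%type) + tseg r z.
Proof.
rewrite /tseg; congr pair => /=.
by rewrite /GRing.scale /=; ring.
Qed.

Lemma tseg_continuous (p : (R^o * (R^o * V))%type) :
  {for p, continuous (fun q : (R^o * (R^o * V))%type => tseg q.1 q.2)}.
Proof.
have c1 : {for p, continuous (fun q : (R^o * (R^o * V))%type => q.1)} by exact: cvg_fst.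
have c2 : {for p, continuous (fun q : (R^o * (R^o * V))%type => q.2)} by exact: cvg_snd.
have c21 : {for p, continuous (fun q : (R^o * (R^o * V))%type => q.2.1)}.
  by apply: (continuous_comp c2); exact: cvg_fst.
have c22 : {for p, continuous (fun q : (R^o * (R^o * V))%type => q.2.2)}.
  by apply: (continuous_comp c2); exact: cvg_snd.
have c : {for p, continuous (fun q : (R^o * (R^o * V))%type =>
    t0 + q.1 * (q.2.1 - t0) : R^o)}.
  apply: cvgD; first exact: cvg_cst.
  apply: cvgM; first exact: c1.
  by apply: cvgB; [exact: c21|exact: cvg_cst].
exact: (cvg_pair c c22).
Qed.

Lemma tseg_continuous_l z r : {for r, continuous (tseg ^~ z)}.
Proof.
have c : {for (r : R^o), continuous (fun s : R^o => (s, z) : (R^o * (R^o * V))%type)}.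
  exact: (cvg_pair cvg_id (cvg_cst z)).
exact: (continuous_comp c (@tseg_continuous (r, z))).
Qed.

(** By compactness of $[0,1]$ one neighbourhood of [z] serves all [r]; this uniformity is what
    allows limits to pass under the integral. *)
Lemma tseg_uniform F z (e : R) : (forall y, E y -> {for y, continuous F}) ->
  E z -> 0 < e -> \forall y \near z, forall r, 0 <= r <= 1 ->
    E (tseg r y) /\ `|F (tseg r y) - F (tseg r z)| <= e.
Proof.
move=> cF Ez e0.
have cpt := @segment_compact R 0 1.
move/compact_near_coveringP: cpt => /(_ _ (nbhs z)
  (fun y r => E (tseg r y) /\ `|F (tseg r y) - F (tseg r z)| <= e)) H.
have {H} : \forall y \near z, `[0, 1]%classic `<=`
    (fun r => E (tseg r y) /\ `|F (tseg r y) - F (tseg r z)| <= e).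
  apply: H => r /=; rewrite in_itv /= => r01.
  have Erz := segE Ez r01.
  have e2 : 0 < e / 2 by rewrite divr_gt0.
  have nQ : \forall p \near tseg r z, E p /\ `|F (tseg r z) - F p| <= e / 2.
    have nE : nbhs (tseg r z) E by exact: (open_nbhs_nbhs (conj oE Erz)).
    have /cvgrPdist_le/(_ _ e2) nF := cF _ Erz.
    exact: (filterI nE nF).
  have n1 : \forall p \near ((r, z) : (R^o * (R^o * V))%type),
      E (tseg p.1 p.2) /\ `|F (tseg r z) - F (tseg p.1 p.2)| <= e / 2.
    exact: (@tseg_continuous (r, z) _ nQ).
  have n2 : \forall s \near r, E (tseg s z) /\
      `|F (tseg r z) - F (tseg s z)| <= e / 2.
    exact: (@tseg_continuous_l z r _ nQ).
  have n3 : filter_prod (nbhs r) (nbhs z) (fun p => E (tseg p.1 z) /\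
      `|F (tseg r z) - F (tseg p.1 z)| <= e / 2).
    exact: (@cvg_fst _ _ (nbhs r) (nbhs z) (nbhs_filter z) _ n2).
  have PF : Filter (filter_prod (nbhs r) (nbhs z)).
    exact: (@filter_prod_filter _ _ _ _ (nbhs_filter r) (nbhs_filter z)).
  have n4 := @filterI _ _ PF _ _ n1 n3.
  suff : filter_prod (nbhs r) (nbhs z) (fun p => E (tseg p.1 p.2) /\
      `|F (tseg p.1 p.2) - F (tseg p.1 z)| <= e) by [].
  apply: (@filterS _ _ PF _ _ _ n4).
  move=> -[s y] /= [[Esy sy] [_ sz]]; split=> //.
  rewrite (splitr e); apply: le_trans (lerD sy sz).
  by rewrite -[X in `|X|](subrKA (F (tseg r z))) (le_trans (ler_normD _ _))// distrC.
apply: filterS => y H r r01; apply: H; by rewrite /= in_itv.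
Qed.

Lemma cont01_tavg j F z : (forall y, E y -> {for y, continuous F}) -> E z ->
  cont01 (fun r => r ^+ j * F (tseg r z)).
Proof.
move=> cF Ez r r01; apply: cvgM; first exact: exprn_continuous.
exact: (continuous_comp (@tseg_continuous_l z r) (cF _ (segE Ez r01))).
Qed.

Lemma tavg_continuous j F z : (forall y, E y -> {for y, continuous F}) -> E z ->
  {for z, continuous (tavg j F)}.
Proof.
move=> cF Ez; apply: continuous_dist => e e0.
have nE : nbhs z E by exact: (open_nbhs_nbhs (conj oE Ez)).
apply: (nbhs_and_sub nE (tseg_uniform cF Ez e0)) => y Ey uy.
apply: int01_dist; try exact: cont01_tavg.
move=> r r01; have [_ uyr] := uy r r01.
rewrite -mulrBr normrM distrC (le_trans _ uyr)// ler_piMl//.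
case/andP: r01 => r0 r1.
by rewrite normrX ger0_norm// exprn_ile1.
Qed.

Lemma Ck_derive_pair k F z (a : R) (u : V) : Ck k.+1 E F -> E z ->
  'D_((a, u) : (R^o * V)%type) F z =
    a * 'D_((1, 0) : (R^o * V)%type) F z + 'D_((0, u) : (R^o * V)%type) F z.
Proof.
move=> Fk Ez.
have -> : ((a, u) : (R^o * V)%type) = a *: ((1, 0) : (R^o * V)%type) + (0, u).
  by congr pair => /=; rewrite ?scaler0 ?add0r// addr0 [RHS]mulr1.
by rewrite (Ck_derive_dirD _ _ oE Fk Ez) (Ck_derive_dirZ _ _ Fk Ez).
Qed.

(** Differentiation under the integral: the mean value theorem for each [r], with partial
    derivatives uniformly close along the segment. A time increment is contracted by the factor [r]
    in [tseg r], hence the extra power in [tavg j.+1]. *)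
Lemma is_derive_tavg k j F z (a : R) (u : V) : Ck k.+1 E F -> E z ->
  is_derive z ((a, u) : (R^o * V)%type) (tavg j F)
    (a * tavg j.+1 ('D_((1, 0) : (R^o * V)%type) F) z +
     tavg j ('D_((0, u) : (R^o * V)%type) F) z).
Proof.
move=> Fk Ez; set w := (a, u); set F1 := 'D_(1, 0) F; set F2 := 'D_(0, u) F.
have cF y : E y -> {for y, continuous F} by exact: (Ck_continuous Fk).
have cF1 y : E y -> {for y, continuous F1} by exact: (Ck_continuous (Ck_derive _ Fk)).
have cF2 y : E y -> {for y, continuous F2} by exact: (Ck_continuous (Ck_derive _ Fk)).
suff H : (fun h => h^-1 *: ((tavg j F \o shift z) (h *: w) - tavg j F z)) @ 0^' -->
    (a * tavg j.+1 F1 z + tavg j F2 z : R^o).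
  by apply: DeriveDef; [apply/cvg_ex; eexists; exact: H|exact: cvg_lim H].
apply/cvgrPdist_le => e e0.
have a10 : 0 < `|a| + 1 by rewrite ltr_wpDl.
(* The errors of the time and space derivatives enter with weights at most $|a|$ and $1$, so this
   tolerance adds up to [e]. *)
have e'0 : 0 < e / (`|a| + 1) by rewrite divr_gt0.
have nE : nbhs z E by exact: (open_nbhs_nbhs (conj oE Ez)).
have n1 := tseg_uniform cF1 Ez e'0; have n2 := tseg_uniform cF2 Ez e'0.
have [d d0 dP] := near_plane w 0 (nbhs_and_sub nE
  (nbhs_and_sub n1 n2 (fun y => @conj _ _)) (fun y => @conj _ _)).
near=> h.
have h0 : h != 0 by near: h; exact: nbhs_dnbhs_neq.
have hd : `|h| < d by near: h; exact: dnbhs0_lt.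
have line s r : 0 <= s <= 1 -> 0 <= r <= 1 ->
    let y := s *: (h *: ((r * a, u) : (R^o * V)%type)) + tseg r z in
    [/\ E y, `|F1 y - F1 (tseg r z)| <= e / (`|a| + 1)
      & `|F2 y - F2 (tseg r z)| <= e / (`|a| + 1)].
  move=> /andP[s0 s1] r01 y.
  have -> : y = tseg r ((s * h) *: w + z) by rewrite tseg_shift /y scalerA.
  have [] := dP (s * h) 0 _ _.
  - by rewrite normrM (le_lt_trans _ hd)// ger0_norm// ler_piMl.
  - by rewrite normr0.
  by rewrite scale0r add0r => _ [] /(_ r r01)[Ey F1y] /(_ r r01)[_ F2y].
have Ehw : E (h *: w + z).
  by have [] := dP h 0 hd; rewrite ?normr0// scale0r add0r.
have c0 := cont01_tavg (j := j) cF Ez; have ch := cont01_tavg (j := j) cF Ehw.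
have c1 := cont01_tavg (j := j.+1) cF1 Ez; have c2 := cont01_tavg (j := j) cF2 Ez.
have cN1 := cont01M (@cont01_cst R (-1)) c0; have ca1 := cont01M (@cont01_cst R a) c1.
have E1 : a * tavg j.+1 F1 z + tavg j F2 z =
    int01 (fun r => r ^+ j * (r * a * F1 (tseg r z) + F2 (tseg r z))).
  rewrite /tavg -(int01Z a c1) -(int01D ca1 c2).
  by apply: eq_int01 => r _; rewrite exprS; ring.
have E2 : h^-1 *: ((tavg j F \o shift z) (h *: w) - tavg j F z) =
    int01 (fun r => r ^+ j * (h^-1 * (F (tseg r (h *: w + z)) - F (tseg r z)))).
  transitivity (h^-1 * (tavg j F (h *: w + z) + -1 * tavg j F z)).
    by rewrite mulN1r.
  rewrite /tavg -(int01Z (-1) c0) -(int01D ch cN1) -(int01Z h^-1 (cont01D ch cN1)).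
  by apply: eq_int01 => r _; ring.
rewrite E1 E2; apply: int01_dist.
- have := cont01D ca1 c2.
  congr cont01; apply/funext => r; rewrite exprS; ring.
- have := cont01M (@cont01_cst R h^-1) (cont01D ch cN1).
  congr cont01; apply/funext => r; ring.
move=> r r01; rewrite tseg_shift.
have [s s01|s /andP[/ltW s0 /ltW s1] ->] :=
    @MVT_direction R _ F (h *: ((r * w.1, w.2) : (R^o * V)%type)) (tseg r z).
  by have [Ey _ _] := line s r s01 r01; exact: (Ck_derivable Fk Ey).
have [Ey F1y F2y] := line s r (introT andP (conj s0 s1)) r01.
rewrite (Ck_derive_dirZ _ _ Fk Ey) (Ck_derive_pair _ _ Fk Ey) -/F1 -/F2.
set y := (s *: _ + _) in Ey F1y F2y *.
rewrite [h *: _]/(h * _) mulKf// -mulrBr.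
have -> : r * a * F1 (tseg r z) + F2 (tseg r z) - (r * w.1 * F1 y + F2 y) =
    - (r * a * (F1 y - F1 (tseg r z)) + (F2 y - F2 (tseg r z))).
  by rewrite /=; ring.
have /andP[r0 r1] := r01.
rewrite normrM normrN (le_trans (ler_piMl _ _))//.
  by rewrite normrX ger0_norm// exprn_ile1.
apply: (le_trans (ler_normD _ _)).
apply: (@le_trans _ _ (`|a| * (e / (`|a| + 1)) + e / (`|a| + 1))).
  rewrite lerD// normrM ler_pM// normrM ler_piMl// ger0_norm//.
by rewrite -{2}[e / _]mul1r -mulrDl mulrC divfK// gt_eqF.
Unshelve. all: by end_near. Qed.

(** The induction runs over all [j] and [F] at once, since a time derivative raises [j]. *)
Lemma Ck_tavg k j F : Ck k E F -> Ck k E (tavg j F).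
Proof.
elim: k j F => [|k IH] j F Fk.
  by split=> // z Ez; apply: tavg_continuous => // y; exact: (Ck_continuous Fk).
split=> [z Ez|[a u]].
  by apply: tavg_continuous => // y; exact: (Ck_continuous Fk).
split=> [z Ez|]; first exact: (ex_derive (is_derive := is_derive_tavg j a u Fk Ez)).
have C1 := IH j.+1 _ (Ck_derive ((1, 0) : (R^o * V)%type) Fk).
have C2 := IH j _ (Ck_derive ((0, u) : (R^o * V)%type) Fk).
apply: (Ck_ext oE _ (CkD oE (CkM oE (Ck_cst _ _ (a : R^o)) C1) C2)) => z Ez.
by rewrite (derive_val (is_derive := is_derive_tavg j a u Fk Ez)).
Qed.

(** The product rule leaves the integral over $r \in [0,1]$ of $F + r\,(z_1 - t_0)\,\partial_t F$
    along the segment. This integrand is the derivative in $r$ of $rF$, so the value is [F] at the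
    end point [tseg 1 z], which is [z]. *)
Lemma derive_time_primitive k F z : Ck k.+1 E F -> E z ->
  'D_((1, 0) : (R^o * V)%type) (fun y => (y.1 - t0) * tavg 0 F y : R^o) z = F z.
Proof.
move=> Fk Ez; set F1 := 'D_((1, 0) : (R^o * V)%type) F.
have cF y : E y -> {for y, continuous F} by exact: (Ck_continuous Fk).
have cF1 y : E y -> {for y, continuous F1} by exact: (Ck_continuous (Ck_derive _ Fk)).
have dp : is_derive z ((1, 0) : (R^o * V)%type) (fun y => y.1 - t0 : R^o) 1.
  have idp : is_derive (z.1 : R^o) 1 (fun s : R^o => s - t0 : R^o) 1.
    by apply: is_derive_eq; rewrite subr0.
  have L h u (x : (R^o * V)%type) : (h *: u + x).1 = h *: u.1 + x.1 by [].
  apply: DeriveDef.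
    by apply: (derivable_affine (f := fun s : R^o => s - t0 : R^o) L); case: idp.
  by rewrite (derive_affine L (fun s : R^o => s - t0 : R^o)); case: idp.
have da := is_derive_tavg 0 1 0 Fk Ez.
rewrite (derive_val (is_derive := is_deriveM dp da)) mul1r.
have -> : tavg 0 ('D_((0, 0) : (R^o * V)%type) F) z = 0.
  rewrite (_ : 'D_(0, 0) F = fun=> 0); last by apply/funext => y; exact: derive0.
  rewrite -[RHS](mul0r (int01 (fun=> 0))) -int01Z; last exact: cont01_cst.
  by apply: eq_int01 => r _; ring.
rewrite addr0.
have dL r : 0 <= r <= 1 -> is_derive (r : R^o) 1 (fun s : R^o => F (tseg s z))
    ((z.1 - t0) * F1 (tseg r z)).
  move=> r01; have Er := segE Ez r01.
  have L (h : R) (u s : R^o) : tseg (h *: u + s) z =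
      h *: ((u * (z.1 - t0), 0) : (R^o * V)%type) + tseg s z.
    rewrite /tseg; congr pair => /=; last by rewrite scaler0 add0r.
    by rewrite /GRing.scale /=; ring.
  have DE : 'D_1 (fun s : R^o => F (tseg s z)) r = (z.1 - t0) * F1 (tseg r z).
    rewrite (derive_affine L F) (Ck_derive_pair _ _ Fk Er) mul1r.
    by rewrite (derive0 F) addr0.
  apply: DeriveDef => //; apply: (derivable_affine (f := F) L).
  exact: (Ck_derivable Fk Er).
have c0 := cont01_tavg (j := 0) cF Ez; have c1 := cont01_tavg (j := 1) cF1 Ez.
have cz1 := cont01M (@cont01_cst R (z.1 - t0)) c1.
transitivity ((z.1 - t0) * tavg 1 F1 z + tavg 0 F z).
  by congr (_ + _); exact: mulr1.
rewrite /tavg -(int01Z _ c1) -(int01D cz1 c0).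
transitivity (1 * F (tseg 1 z) - 0 * F (tseg 0 z)); last first.
  rewrite mul1r mul0r subr0; congr F.
  by rewrite /tseg mul1r addrC subrK; case: z {Ez dp da dL c0 c1 cz1}.
apply: (@int01_derive _ (fun r => r * F (tseg r z))); first exact: cont01D cz1 c0.
move=> r /dL dLr.
have di := is_derive_id (r : R^o) (1 : R^o).
apply: (is_derive_eq (is_deriveM di dLr)).
by rewrite /GRing.scale /= expr0 expr1; ring.
Qed.

End TimeAverage.

(** * Uniqueness for linear transport equations *)

Section ContinuousAt.
Context {R : realType} {U U' : normedModType R}.
Implicit Types (f g : U -> R^o) (x : U).

Lemma contD f g x : {for x, continuous f} -> {for x, continuous g} ->
  {for x, continuous (fun y => f y + g y : R^o)}.
Proof. by move=> fc gc; apply: cvgD. Qed.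

Lemma contB f g x : {for x, continuous f} -> {for x, continuous g} ->
  {for x, continuous (fun y => f y - g y : R^o)}.
Proof. by move=> fc gc; apply: cvgB. Qed.

Lemma contM f g x : {for x, continuous f} -> {for x, continuous g} ->
  {for x, continuous (fun y => f y * g y : R^o)}.
Proof. by move=> fc gc; apply: cvgM. Qed.

Lemma contC (c : R^o) x : {for x, continuous (fun=> c : R^o)}.
Proof. exact: cvg_cst. Qed.

Lemma cont_sum (J : Type) (r : seq J) (f : J -> U -> R^o) x :
  (forall j, {for x, continuous (f j)}) ->
  {for x, continuous (fun y => \sum_(j <- r) f j y : R^o)}.
Proof.
move=> fc; elim: r => [|j r IH].
  by rewrite (_ : (fun y => _) = fun=> 0); [exact: contC|apply/funext => y; rewrite big_nil].
rewrite (_ : (fun y => _) = fun y => f j y + \sum_(k <- r) f k y); first exact: contD.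
by apply/funext => y; rewrite big_cons.
Qed.

Lemma cont_comp (h : U -> U') (f : U' -> R^o) x : {for x, continuous h} ->
  {for h x, continuous f} -> {for x, continuous (fun y => f (h y))}.
Proof. by move=> hc fc; exact: (continuous_comp hc fc). Qed.

Lemma cont_max0 f x : {for x, continuous f} ->
  {for x, continuous (fun y => Num.max (f y) 0 : R^o)}.
Proof.
move=> fc; have nc : {for x, continuous (fun y => `|f y| : R^o)} by exact: cvg_norm.
have mc := contM (contD fc nc) (@contC (2^-1) x).
rewrite (_ : (fun y => _) = fun y => (f y + `|f y|) * 2^-1); first exact: mc.
by apply/funext => y; rewrite maxr_absE addr0 subr0.
Qed.

End ContinuousAt.

Arguments contC {R U} c x.

Lemma is_derive_sumr (R : realType) (U : normedModType R) (J : Type) (r : seq J)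
    (f : J -> U -> R^o) (df : J -> R) (x v : U) :
  (forall j, is_derive x v (f j) (df j : R^o)) ->
  is_derive x v (fun y => \sum_(j <- r) f j y : R^o) (\sum_(j <- r) df j : R^o).
Proof.
move=> fd; elim: r => [|j r IH].
  rewrite (_ : (fun y => _) = cst 0) ?big_nil; first exact: is_derive_cst.
  by apply/funext => y; rewrite big_nil.
rewrite (_ : (fun y => _) = f j + (fun y => \sum_(k <- r) f k y)).
  by rewrite big_cons; apply: is_deriveD.
by apply/funext => y; rewrite big_cons.
Qed.

Lemma is_derive_affine1 (R : realType) (a b x : R) :
  is_derive (x : R^o) 1 (fun t : R^o => t * a + b : R^o) a.
Proof.
have H := is_deriveD (is_deriveM (is_derive_id (x : R^o) (1 : R^o))
  (is_derive_cst (a : R^o) (x : R^o) (1 : R^o))) (is_derive_cst (b : R^o) (x : R^o) 1).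
by apply: (is_derive_eq H); rewrite scaler0 add0r addr0 [LHS]mulr1.
Qed.

(** In [cone_zero] the maximum may lie on the last time slice, so only the side [sg * t <= 0] is
    available for comparison. A negative [sg * d] is refuted by a small step [- sg * m] into that
    side. *)
Lemma one_sided_max_derive (R : realType) (phi : R^o -> R^o) (d sg : R) :
  sg = 1 \/ sg = -1 -> is_derive (0 : R^o) 1 phi d ->
  (\forall t \near (0 : R), sg * t <= 0 -> phi t <= phi 0) -> 0 <= sg * d.
Proof.
move=> sgE [dphi dE] phi_max; rewrite leNgt; apply/negP => sgd.
have cvgd : (fun h => h^-1 *: ((phi \o shift 0) (h *: (1 : R^o)) - phi 0)) @ 0^' --> (d : R^o).
  by rewrite -dE; exact: dphi.
have nd : \forall h \near 0^', sg * (h^-1 * (phi h - phi 0)) < 0.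
  have e0 : 0 < - (sg * d) by rewrite oppr_gt0.
  move/cvgrPdist_lt: cvgd => /(_ _ e0); apply: filterS => h /=.
  rewrite addr0 [_%:A]mulr1 [_ *: _]/(_ * _) => hd.
  rewrite -[X in X < _](subrK (sg * d)) -mulrBr -ltrBrDr sub0r.
  apply: le_lt_trans hd; rewrite distrC (le_trans (ler_norm _))// normrM.
  by case: sgE => ->; rewrite ?normrN1 ?normr1 mul1r.
move: nd => /nbhs_ballP[e /= e0 eP]; move: phi_max => /nbhs_ballP[e' /= e'0 e'P].
have m0 : 0 < Num.min e e' / 2 by rewrite divr_gt0// lt_min e0.
set m := Num.min e e' / 2 in m0; pose h := - sg * m.
have nh : `|h| = m.
  by rewrite /h normrM normrN (gtr0_norm m0); case: sgE => ->;
    rewrite ?normrN1 ?normr1 mul1r.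
have hlt : `|h| < Num.min e e' by rewrite nh ltr_pdivrMr// ltr_pMr ?ltr1n// lt_min e0.
have sgsg : sg * sg = 1 by case: sgE => ->; rewrite ?mulrNN mulr1.
have h0 : h != 0 by rewrite -normr_gt0 nh.
have hb x : `|h| < x -> ball (0 : R) x h by rewrite -ball_normE /= sub0r normrN.
have he : `|h| < e by apply: lt_le_trans hlt _; rewrite ge_min lexx.
have he' : `|h| < e' by apply: lt_le_trans hlt _; rewrite ge_min lexx orbT.
have := eP _ (hb _ he) h0.
have : phi h <= phi 0.
  by apply: (e'P _ (hb _ he')); rewrite /h mulrA mulrN sgsg mulN1r oppr_le0 ltW.
rewrite -subr_le0 => le0; apply/negP; rewrite -leNgt mulrA.
apply: mulr_le0 => //.
have -> : sg * h^-1 = - m^-1.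
  by rewrite /h invfM mulrA invrN mulrN; case: sgE => ->;
    rewrite ?invrN ?mulrNN invr1 mulr1 mulN1r.
by rewrite oppr_le0 invr_ge0 ltW.
Qed.

(** * The maximum principle on a shrinking cone *)

Section Cone.
Context {R : realType} {n : nat} {J : finType}.
Variables (w : J -> (R^o * 'rV[R]_n)%type -> R^o).
Variables (vel : (R^o * 'rV[R]_n)%type -> 'rV[R]_n).
Variables (B : J -> J -> (R^o * 'rV[R]_n)%type -> R).
Variables (s : R) (x0 : 'rV[R]_n) (B0 S : R).

(** The Euclidean square is used because it is differentiable, unlike the norm of ['rV[R]_n], which
    is the maximum norm. *)
Let sq (x : 'rV[R]_n) : R := \sum_c (x 0 c - x0 0 c) ^+ 2.

Let energy (z : (R^o * 'rV[R]_n)%type) : R := \sum_j w j z ^+ 2.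

Definition transport_at (z : (R^o * 'rV[R]_n)%type) :=
  [/\ forall j, {for z, continuous (w j)},
      forall j, is_derive z ((1, vel z) : (R^o * 'rV[R]_n)%type) (w j)
        (\sum_k B j k z * w k z : R^o),
      forall j k, `|B j k z| <= B0
    & `|vel z| <= S].

(** The first summand pays for the growth of the energy, whose weight is at most [r ^+ 2]; the
    second for the change of [sq] when a point of the box moves with speed at most [S]; the final 1
    makes the inequality strict. *)
Let cone_speed (r : R) :=
  r ^+ 2 * (2 * #|J|%:R * B0) + 2 * n%:R * r * S + 1.

Let sq_continuous : continuous (sq : 'rV[R]_n -> R^o).
Proof.
move=> x; apply: (@Ck_continuous _ _ _ 0 setT) => //.
apply: Ck_sum => [|c]; first exact: openT.
have C1 : Ck 0 setT (fun x : 'rV[R]_n => x 0 c - x0 0 c : R^o).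
  apply: (CkB openT _ (Ck_cst _ _ _)); apply: (Ck_mx _ _ openT).
  by split=> // y _; exact: cvg_id.
exact: (CkM openT C1 C1).
Qed.

Let sq_ge0 x : 0 <= sq x.
Proof. by apply: sumr_ge0 => c _; exact: sqr_ge0. Qed.

Let norm_lt_sq x (r : R) : 0 < r -> sq x < r ^+ 2 -> `|x - x0| < r.
Proof.
move=> r0 sqr; rewrite [ltLHS]/Num.Def.normr/= mx_normrE.
apply: bigmax_lt => // -[i c] _; rewrite /= ord1 !mxE.
rewrite -(@ltr_pXn2r _ 2)// ?nnegrE ?ltW// real_normK ?num_real//.
by apply: le_lt_trans sqr; rewrite /sq (bigD1 c)//= lerDl sumr_ge0// => ? _; exact: sqr_ge0.
Qed.

(** From $2|ab| \le a^2 + b^2$: in the double sum over [j] and [k] each square appears $2\,|J|$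
    times with the factor [B0]. *)
Let energy_rate_bound z : (forall j k, `|B j k z| <= B0) ->
  `|\sum_j 2 * w j z * \sum_k B j k z * w k z| <= 2 * #|J|%:R * B0 * energy z.
Proof.
move=> BB.
apply: (le_trans (ler_norm_sum _ _ _)).
apply: (@le_trans _ _ (\sum_j \sum_k B0 * (w j z ^+ 2 + w k z ^+ 2))).
  apply: ler_sum => j _; rewrite mulr_sumr (le_trans (ler_norm_sum _ _ _))//.
  apply: ler_sum => k _.
  rewrite (_ : 2 * w j z * (B j k z * w k z) = B j k z * (2 * w j z * w k z)); last by ring.
  rewrite normrM; apply: ler_pM => //.
  rewrite ler_norml; apply/andP; split.
    by rewrite -subr_ge0 (_ : _ - _ = (w j z + w k z) ^+ 2) ?sqr_ge0//; ring.
  by rewrite -subr_ge0 (_ : _ - _ = (w j z - w k z) ^+ 2) ?sqr_ge0//; ring.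
have inner a : \sum_k B0 * (a + w k z ^+ 2) = B0 * (a *+ #|J| + energy z).
  by rewrite -mulr_sumr big_split /= sumr_const.
under eq_bigr do rewrite inner.
rewrite -mulr_sumr big_split /= sumr_const sumrMnl.
have <- : energy z = \sum_j w j z ^+ 2 by [].
move: (energy z) #|J| => e m; rewrite -(mulr_natr e m) le_eqVlt.
by apply/orP; left; apply/eqP; ring.
Qed.

Let box_norm (r : R) (x : 'rV[R]_n) :
  0 <= r -> (forall c, `|x 0 c - x0 0 c| <= r) -> `|x - x0| <= r.
Proof.
move=> r0 xr; rewrite [leLHS]/Num.Def.normr/= mx_normrE.
by apply: bigmax_le => // -[i c] _; rewrite /= ord1 !mxE.
Qed.

(* If the energy times [r^2 - |x - x0|^2 - cone_speed r * t] had a positive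
   maximum over [0, d] times a box, its derivative along the characteristic
   direction [(1, vel)] would have the wrong sign there: [cone_speed] dominates
   both the zeroth-order term and the motion of the sphere. [sg] is the direction
   of time. *)
Lemma cone_zero (sg r d : R) : sg = 1 \/ sg = -1 -> 0 < r -> 0 < d ->
  (forall t x, 0 <= t <= d -> `|x - x0| <= r -> transport_at (s + sg * t, x)) ->
  (forall x j, `|x - x0| <= r -> w j (s, x) = 0) ->
  forall t x, 0 <= t <= d -> sq x + cone_speed r * t < r ^+ 2 ->
    forall j, w j (s + sg * t, x) = 0.
Proof.
move=> sgE r0 d0 tr w0.
pose K := cone_speed r.
pose chi (p : (R^o * 'rV[R]_n)%type) : R^o := r ^+ 2 - sq p.2 - K * p.1.
pose z (p : (R^o * 'rV[R]_n)%type) : (R^o * 'rV[R]_n)%type := (s + sg * p.1, p.2).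
(* Truncating [chi] at 0 makes [q] nonnegative on the box and zero outside the cone, so a positive
   maximum is attained inside the cone. *)
pose q (p : (R^o * 'rV[R]_n)%type) : R^o := energy (z p) * Num.max (chi p) 0.
pose box : set 'rV[R]_n :=
  [set x | forall c, `[x0 0 c - r, x0 0 c + r]%classic (x ord0 c)].
have boxE x : box x <-> `|x - x0| <= r.
  split=> [bx|xr c].
    by apply: box_norm => [|c]; [exact: ltW|have := bx c; rewrite /= in_itv /= ler_distl].
  rewrite /= in_itv /= -ler_distl; apply: le_trans xr.
  by have := rV_entry_norm (x - x0) c; rewrite !mxE.
pose A : set (R^o * 'rV[R]_n)%type := `[0, d]%classic `*` box.
have cA : compact A.
  apply: compact_setX; first exact: segment_compact.
  by apply: (@rV_compact R n (fun c => `[x0 0 c - r, x0 0 c + r]%classic)) => c;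
    exact: segment_compact.
have S0 : 0 <= S.
  have tr0 : transport_at (s + sg * 0, x0).
    apply: tr; last by rewrite subrr normr0 ltW.
    by rewrite lexx ltW.
  by case: tr0 => _ _ _; exact: le_trans.
have fst_cont (p : (R^o * 'rV[R]_n)%type) :
  {for p, continuous (fst : (R^o * 'rV[R]_n)%type -> R^o)} by exact: cvg_fst.
have snd_cont (p : (R^o * 'rV[R]_n)%type) :
  {for p, continuous (snd : (R^o * 'rV[R]_n)%type -> 'rV[R]_n)} by exact: cvg_snd.
have z_cont (p : (R^o * 'rV[R]_n)%type) : {for p, continuous z}.
  exact: (cvg_pair (contD (contC s p) (contM (contC sg p) (fst_cont p))) (snd_cont p)).
have chi_cont (p : (R^o * 'rV[R]_n)%type) : {for p, continuous chi}.
  have sqc := cont_comp (f := sq : 'rV[R]_n -> R^o) (snd_cont p) (@sq_continuous p.2).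
  exact: (contB (contB (contC (r ^+ 2) p) sqc) (contM (contC K p) (fst_cont p))).
have cq : {within A, continuous q}.
  apply: continuous_in_subspaceT => -[t x] /[!inE] -[/= td /boxE xr].
  rewrite in_itv /= in td; have [wc _ _ _] := tr t x td xr.
  have ec := @cont_sum R _ J (index_enum J) _ _ (fun j => contM (wc j) (wc j)).
  exact: (contM (cont_comp (f := energy : _ -> R^o) (z_cont (t, x)) ec)
    (cont_max0 (chi_cont (t, x)))).
have A0 : A !=set0.
  exists (0, x0); split => /=; first by rewrite in_itv /= lexx ltW.
  by apply/boxE; rewrite subrr normr0 ltW.
have [[t1 x1] /[!inE] -[/= t1d x1r] qmax] := compact_EVT_max A0 cA cq.
(* The sign of [B0] can be read off only when [J] is inhabited; for empty [J] the product is 0. *)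
have JB0 : 0 <= #|J|%:R * B0.
  have [j|J0] := pickP (fun _ : J => true).
    have tr0 : transport_at (s + sg * 0, x0).
      apply: tr; last by rewrite subrr normr0 ltW.
      by rewrite lexx ltW.
    by rewrite mulr_ge0//; case: tr0 => _ _ /(_ j j) + _; exact: le_trans.
  by rewrite (eq_card0 J0) mul0r.
have K0 : 0 <= K.
  rewrite /K /cone_speed !addr_ge0//.
    by rewrite mulr_ge0 ?sqr_ge0// -mulrA mulr_ge0.
  by rewrite !mulr_ge0// ltW.
have energy_ge0 p : 0 <= energy p by apply: sumr_ge0 => j _; exact: sqr_ge0.
have energy_eq0 p j : energy p = 0 -> w j p = 0.
  have w2 k : true -> 0 <= w k p ^+ 2 by move=> _; exact: sqr_ge0.
  by move=> /(psumr_eq0P w2)/(_ j isT)/eqP; rewrite sqrf_eq0 => /eqP.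
(* With no positive maximum, the energy vanishes wherever [chi] is positive, which is the claim. *)
have [q_le0|q_gt0] := leP (q (t1, x1)) 0.
  move=> t x td lt_r j.
  have t0 : 0 <= t by case/andP: td.
  have xA : (t, x) \in A.
    rewrite inE; split; first by rewrite /= in_itv.
    apply/boxE/ltW; apply: norm_lt_sq => //; apply: le_lt_trans lt_r.
    by rewrite lerDl mulr_ge0.
  have chi0 : 0 < chi (t, x) by rewrite /chi /= -addrA -opprD subr_gt0.
  have := le_trans (qmax _ xA) q_le0.
  rewrite /q (max_l (ltW chi0)) pmulr_lle0// => e0.
  by apply: energy_eq0; apply/eqP; rewrite eq_le e0 energy_ge0.
exfalso.
rewrite in_itv /= in t1d; have t1_ge0 : 0 <= t1 by case/andP: t1d.
have x1r' := (boxE _).1 x1r.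
have chi_gt0 : 0 < chi (t1, x1).
  rewrite ltNge; apply/negP => chi_le0; move: q_gt0.
  by rewrite /q (max_r chi_le0) mulr0 ltxx.
have e_gt0 : 0 < energy (z (t1, x1)).
  by move: q_gt0; rewrite /q (max_l (ltW chi_gt0)) pmulr_lgt0.
(* At cone time 0 the energy vanishes by the initial condition, so there is room to step back from
   the maximum. *)
have t1_gt0 : 0 < t1.
  rewrite lt_neqAle t1_ge0 andbT; apply/eqP => t10; move: e_gt0.
  rewrite /energy big1 ?ltxx// => j _.
  by rewrite /z /= -t10 mulr0 addr0 w0// expr0n.
have x1_lt : `|x1 - x0| < r.
  apply: norm_lt_sq => //; move: chi_gt0; rewrite /chi /= -addrA -opprD subr_gt0.
  by apply: le_lt_trans; rewrite lerDl mulr_ge0.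
have [_ wd BB vS] := tr t1 x1 t1d x1r'.
set zs := z (t1, x1); set v := vel zs in vS.
(* The untruncated product along the straight line through [zs] with velocity frozen at [v]. Its
   parameter is true time, so the cone time is [t * sg + t1]; the weight is expanded into a
   polynomial in [t] to be differentiated. *)
pose phi (t : R^o) : R^o := energy (t *: (((1, v) : (R^o * 'rV[R]_n)%type)) + zs) *
  (r ^+ 2 - \sum_c (t * v 0 c + (x1 0 c - x0 0 c)) ^+ 2 - K * (t * sg + t1)).
have sgsg : sg * sg = 1 by case: sgE => ->; rewrite ?mulrNN mulr1.
have sg_norm : `|sg| = 1 by case: sgE => ->; rewrite ?normrN1 ?normr1.
have phiE t : phi t = energy (z (t * sg + t1, t *: v + x1)) *
    chi (t * sg + t1, t *: v + x1).
  rewrite /phi /chi /sq /=; congr (energy _ * (_ - _ - _)).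
    rewrite /zs /z /=; congr pair => /=.
    by rewrite /GRing.scale /= mulr1 mulrDr mulrCA sgsg mulr1 addrCA addrA.
  by apply: eq_bigr => c _; rewrite !mxE addrA.
have phi_max : \forall t \near (0 : R), sg * t <= 0 -> phi t <= phi 0.
  (* Small enough that stepping back keeps the cone time nonnegative and that the displacement
     [t *: v] does not leave the box. *)
  pose m := Num.min t1 ((r - `|x1 - x0|) / (`|v| + 1)).
  have v1 : 0 < `|v| + 1 by rewrite ltr_wpDl.
  have m0 : 0 < m by rewrite lt_min t1_gt0 divr_gt0// subr_gt0.
  apply/nbhs_ballP; exists m => //= t; rewrite -ball_normE /= sub0r normrN => tm sgt.
  have tt1 : `|t| < t1 by apply: lt_le_trans tm _; rewrite ge_min lexx.
  have tr1 : `|t| < (r - `|x1 - x0|) / (`|v| + 1).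
    by apply: lt_le_trans tm _; rewrite ge_min lexx orbT.
  have pA : (t * sg + t1, t *: v + x1) \in A.
    rewrite inE; split => /=.
      rewrite in_itv /= mulrC; apply/andP; split.
        have : `|sg * t| < t1 by rewrite normrM sg_norm mul1r.
        by rewrite ltr_norml -subr_gt0 opprK => /andP[/ltW].
      by case/andP: t1d => _; apply: le_trans; rewrite gerDr.
    apply/boxE; rewrite -addrA (le_trans (ler_normD _ _))// -lerBrDr normrZ.
    rewrite ltr_pdivlMr// in tr1; apply: le_trans (ltW tr1).
    by rewrite ler_wpM2l// lerDl.
  have := qmax _ pA; rewrite /q (max_l (ltW chi_gt0)).
  rewrite [phi 0]phiE mul0r add0r scale0r add0r; apply: le_trans.
  by rewrite phiE ler_wpM2l// le_max lexx.
pose dE : R := \sum_j 2 * w j zs * \sum_k B j k zs * w k zs.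
pose dX : R := - (\sum_c 2 * v 0 c * (x1 0 c - x0 0 c)) - K * sg.
pose line (t : R^o) : (R^o * 'rV[R]_n)%type :=
  t *: (((1, v) : (R^o * 'rV[R]_n)%type)) + zs.
have line0 : line 0 = zs by rewrite /line scale0r add0r.
have wline j : is_derive (0 : R^o) 1 (fun t : R^o => w j (line t))
    (\sum_k B j k zs * w k zs : R^o).
  have [wdj wdE] := wd j; apply: DeriveDef.
    by apply: (@derivable_line R _ _ (w j)); rewrite -/(line 0) line0.
  by rewrite (@derive_line R _ _ (w j)) -/(line 0) line0.
have E_d : is_derive (0 : R^o) 1 (fun t : R^o => energy (line t) : R^o) (dE : R^o).
  apply: is_derive_sumr => j.
  rewrite (_ : (fun t => _) = (fun t : R^o => w j (line t)) * (fun t => w j (line t))).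
    apply: (is_derive_eq (is_deriveM (wline j) (wline j))).
    by rewrite line0 /GRing.scale /=; ring.
  by apply/funext => t; rewrite expr2.
pose X (t : R^o) : R^o :=
  r ^+ 2 - \sum_c (t * v 0 c + (x1 0 c - x0 0 c)) ^+ 2 - K * (t * sg + t1).
have X_d : is_derive (0 : R^o) 1 X (dX : R^o).
  have sq_d c : is_derive (0 : R^o) 1
      (fun t : R^o => (t * v 0 c + (x1 0 c - x0 0 c)) ^+ 2 : R^o)
      (2 * v 0 c * (x1 0 c - x0 0 c) : R^o).
    have ad := is_derive_affine1 (v 0 c) (x1 0 c - x0 0 c) 0.
    rewrite (_ : (fun t => _) = (fun t : R^o => t * v 0 c + (x1 0 c - x0 0 c) : R^o) *
        (fun t => t * v 0 c + (x1 0 c - x0 0 c))).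
      apply: (is_derive_eq (is_deriveM ad ad)).
      by rewrite /GRing.scale /= mul0r add0r; ring.
    by apply/funext => t; rewrite expr2.
  have s_d := @is_derive_sumr _ _ _ (index_enum 'I_n) _ _ _ _ sq_d.
  have k_d := is_deriveZ K (is_derive_affine1 sg t1 0).
  have c_d := is_derive_cst (r ^+ 2 : R^o) (0 : R^o) (1 : R^o).
  apply: (is_derive_eq (is_deriveB (is_deriveB c_d s_d) k_d)).
  by rewrite sub0r.
have phi_d : is_derive (0 : R^o) 1 phi (energy zs * dX + chi (t1, x1) * dE : R^o).
  apply: (is_derive_eq (is_deriveM E_d X_d)).
  rewrite line0; congr (_ + _ * _).
  rewrite /X /chi /sq /= mul0r add0r; congr (_ - _ - _).
  by apply: eq_bigr => c _; rewrite mul0r add0r.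
have := one_sided_max_derive sgE phi_d phi_max; apply/negP; rewrite -ltNge.
have dX_bound : sg * dX <= 2 * n%:R * r * S - K.
  rewrite /dX mulrBr [sg * (K * sg)]mulrCA sgsg mulr1 lerD2r.
  apply: le_trans (ler_norm _) _; rewrite normrM sg_norm mul1r normrN.
  apply: (le_trans (ler_norm_sum _ _ _)).
  apply: (@le_trans _ _ (\sum_(c < n) 2 * S * r)).
    apply: ler_sum => c _; rewrite !normrM (@ger0_norm _ 2)//.
    rewrite ler_pM// ?mulr_ge0//.
      by rewrite ler_wpM2l// (le_trans (rV_entry_norm _ _)).
    by apply: le_trans x1r'; have := rV_entry_norm (x1 - x0) c; rewrite !mxE.
  rewrite sumr_const card_ord -(mulr_natr (2 * S * r) n) le_eqVlt.
  by apply/orP; left; apply/eqP; ring.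
have dE_bound : sg * dE <= 2 * #|J|%:R * B0 * energy zs.
  apply: le_trans (energy_rate_bound BB); apply: le_trans (ler_norm _) _.
  by rewrite normrM sg_norm mul1r.
have chi_r : chi (t1, x1) <= r ^+ 2.
  by rewrite /chi /= -addrA -opprD gerBl addr_ge0// mulr_ge0.
rewrite mulrDr !(mulrCA sg).
apply: (@le_lt_trans _ _ (energy zs * (2 * n%:R * r * S - K) +
    r ^+ 2 * (2 * #|J|%:R * B0 * energy zs))).
  apply: lerD; first by rewrite ler_wpM2l.
  apply: (@le_trans _ _ (chi (t1, x1) * (2 * #|J|%:R * B0 * energy zs))).
    by rewrite ler_wpM2l// ltW.
  by rewrite ler_wpM2r// mulr_ge0// -mulrA mulr_ge0.
rewrite (_ : _ + _ = - energy zs) ?oppr_lt0//.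
by rewrite /K /cone_speed; ring.
Qed.

(** Cones are run forwards and backwards from the slice at time [s]. The choice of [r] keeps the box
    inside both given neighbourhoods, and [d] is so small that $|K|\,d < r^2/2$; hence up to cone
    time [d] the cone still contains the fixed neighbourhood [sq x < r ^+ 2 / 2] of [x0]. *)
Lemma transport_zero :
  nbhs ((s, x0) : (R^o * 'rV[R]_n)%type) transport_at ->
  nbhs x0 (fun x => forall j, w j (s, x) = 0) ->
  nbhs ((s, x0) : (R^o * 'rV[R]_n)%type) (fun z => forall j, w j z = 0).
Proof.
move=> /nbhs_ballP[e1 /= e1_gt0 tr] /nbhs_ballP[e2 /= e2_gt0 w0].
have half_lt (e : R) : 0 < e -> e / 2 < e by move=> e0; rewrite ltr_pdivrMr// ltr_pMr// ltr1n.
pose r := Num.min e1 e2 / 2.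
have m_gt0 : 0 < Num.min e1 e2 by rewrite lt_min e1_gt0.
have r_gt0 : 0 < r by rewrite divr_gt0.
have r1 : r < e1 by apply: lt_le_trans (half_lt _ m_gt0) _; rewrite ge_min lexx.
have r2 : r < e2 by apply: lt_le_trans (half_lt _ m_gt0) _; rewrite ge_min lexx orbT.
pose K := cone_speed r; have K1 : 0 < `|K| + 1 by rewrite ltr_wpDl.
have r4 : 0 < r ^+ 2 / 2 by rewrite divr_gt0// exprn_gt0.
pose d := Num.min (e1 / 2) (r ^+ 2 / 2 / (`|K| + 1)).
have d_gt0 : 0 < d by rewrite lt_min !divr_gt0// exprn_gt0.
have d1 : d < e1 by apply: le_lt_trans (half_lt _ e1_gt0); rewrite ge_min lexx.
have Kd : `|K| * d < r ^+ 2 / 2.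
  apply: (@lt_le_trans _ _ ((`|K| + 1) * d)); first by rewrite ltr_pM2r// ltrDl.
  by rewrite mulrC -ler_pdivlMr// ge_min lexx orbT.
have cone sg : sg = 1 \/ sg = -1 -> forall t x, 0 <= t <= d -> sq x < r ^+ 2 / 2 ->
    forall j, w j (s + sg * t, x) = 0.
  move=> sgE t x td sqx; apply: (@cone_zero sg r d) => //.
  - move=> t' x' /andP[t0 t'd] x'r; apply: tr; split => /=.
      rewrite -ball_normE /= opprD addrA subrr sub0r normrN normrM.
      rewrite (ger0_norm t0) (_ : `|sg| = 1) ?mul1r ?(le_lt_trans t'd)//.
      by case: sgE => ->; rewrite ?normrN1 ?normr1.
    by rewrite -ball_normE /= distrC (le_lt_trans x'r).
  - by move=> x' j x'r; apply: w0; rewrite -ball_normE /= distrC (le_lt_trans x'r).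
  rewrite (splitr (r ^+ 2)) ltrD// (le_lt_trans _ Kd)//.
  case/andP: td => t0 td; apply: (@le_trans _ _ (`|K| * t)).
    by rewrite ler_wpM2r// ler_norm.
  by rewrite ler_wpM2l.
have nsq : nbhs x0 (fun x => sq x < r ^+ 2 / 2).
  have := @sq_continuous x0; rewrite /continuous_at /=.
  have -> : sq x0 = 0 by rewrite /sq big1// => c _; rewrite subrr expr0n.
  move/cvgrPdist_lt => /(_ _ r4); apply: filterS => x.
  by rewrite sub0r normrN; apply: le_lt_trans; exact: ler_norm.
have ns : nbhs (s : R^o) (fun t => `|s - t| < d).
  by apply/nbhs_ballP; exists d => //= t; rewrite -ball_normE.
exists ([set t : R^o | `|s - t| < d], [set x | sq x < r ^+ 2 / 2]) => //.
move=> [t x] /= [td sqx] j.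
have [ts|st] := leP t s.
  have -> : t = s + -1 * (s - t) by ring.
  by apply: cone => //; [right|rewrite subr_ge0 ts (le_trans (ler_norm _))// ltW].
have -> : t = s + 1 * (t - s) by ring.
apply: cone => //; [by left|rewrite subr_ge0 (ltW st) (le_trans (ler_norm _))// distrC ltW//].
Qed.

End Cone.

(** * The momentum equation for the covector field and the vorticity *)

Section CovariantMomentum.
Context {R : realType} {n : nat}.
Variables (G : 'M[R]_n) (dG : 'I_n -> 'I_n -> 'I_n -> R).
Variables (V Vt df : 'I_n -> R) (dV : 'I_n -> 'I_n -> R).
Hypothesis G_sym : forall a b, G a b = G b a.
Hypothesis dG_sym : forall a b c, dG a b c = dG a c b.
Hypothesis G_unit : G \in unitmx.

Let Gamma c a b : R :=
  2^-1 * \sum_d invmx G c d * (dG a b d + dG b a d - dG d a b).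

Hypothesis momentum : forall c,
  Vt c + (\sum_a V a * dV a c + \sum_a \sum_b Gamma c a b * V a * V b) +
    \sum_e df e * invmx G e c = 0.

Let lower_invmx d (x : 'I_n -> R) :
  \sum_c G d c * \sum_e invmx G c e * x e = x d.
Proof.
have /matrixP/(_ d 0) : G *m (invmx G *m \col_e x e) = \col_e x e by rewrite mulKVmx.
rewrite !mxE => E; rewrite -[RHS]E; apply: eq_bigr => c _; rewrite !mxE.
by congr (_ * _); apply: eq_bigr => e _; rewrite !mxE.
Qed.

Let lower_invmx_sym d (x : 'I_n -> R) :
  \sum_c G d c * \sum_e x e * invmx G e c = x d.
Proof.
have GT : G^T = G by apply/matrixP => a b; rewrite mxE.
have iG a b : invmx G a b = invmx G b a by rewrite -{1}GT -trmx_inv mxE.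
rewrite -[RHS]lower_invmx; apply: eq_bigr => c _; congr (_ * _).
by apply: eq_bigr => e _; rewrite mulrC iG.
Qed.

(** Here [dG a b c] stands for $\partial_a G_{bc}$, [dV a c] for $\partial_a V^c$ and [Vt] for the
    time derivative of $V$. With $\alpha_d = \sum_c G_{dc} V^c$, the difference of sums over [c] is
    $\partial_a \alpha_d - \partial_d \alpha_a$ after the product rule, and the last double sum is
    $\partial_d |V|^2$. *)
Lemma covariant_momentum d :
  \sum_c G d c * Vt c =
    - (\sum_a V a * (\sum_c (dG a d c * V c + G d c * dV a c)
                   - \sum_c (dG d a c * V c + G a c * dV d c)))
    - (2^-1 * \sum_a \sum_b (dG d a b * V a * V b + G a b * dV d a * V b
                           + G a b * V a * dV d b) + df d).
Proof.
have : \sum_c G d c * (Vt c + (\sum_a V a * dV a c +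
    \sum_a \sum_b Gamma c a b * V a * V b) + \sum_e df e * invmx G e c) = 0.
  by rewrite big1// => c _; rewrite momentum mulr0.
under eq_bigr do rewrite !mulrDr.
rewrite !big_split /= lower_invmx_sym.
(* The symmetries of [G] and [dG] bring every quadratic term to one of these four contractions; what
   remains is linear arithmetic in them. *)
pose A1 := \sum_a \sum_b dG a b d * V a * V b.
pose A2 := \sum_a \sum_b dG d a b * V a * V b.
pose A3 := \sum_a \sum_c V a * G d c * dV a c.
pose A4 := \sum_a \sum_b G a b * V a * dV d b.
have -> : \sum_c G d c * \sum_a V a * dV a c = A3.
  under eq_bigr do rewrite mulr_sumr.
  rewrite exchange_big /=; apply: eq_bigr => a _; apply: eq_bigr => c _; ring.
have -> : \sum_c G d c * \sum_a \sum_b Gamma c a b * V a * V b =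
    2^-1 * (A1 + A1 - A2).
  transitivity (\sum_a \sum_b 2^-1 * (dG a b d + dG b a d - dG d a b) * V a * V b).
    under eq_bigr do rewrite mulr_sumr.
    rewrite exchange_big /=; apply: eq_bigr => a _.
    under eq_bigr do rewrite mulr_sumr.
    rewrite exchange_big /=; apply: eq_bigr => b _.
    rewrite -(lower_invmx d (fun d => dG a b d + dG b a d - dG d a b)).
    rewrite mulr_sumr !mulr_suml; apply: eq_bigr => c _.
    by rewrite /Gamma; ring.
  have A1' : A1 = \sum_a \sum_b dG b a d * V a * V b.
    rewrite /A1 exchange_big /=; apply: eq_bigr => a _; apply: eq_bigr => b _; ring.
  rewrite {2}A1' /A1 /A2 -big_split -sumrB mulr_sumr; apply: eq_bigr => a _.
  rewrite -big_split -sumrB mulr_sumr; apply: eq_bigr => b _ /=; ring.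
have -> : \sum_a V a * (\sum_c (dG a d c * V c + G d c * dV a c) -
    \sum_c (dG d a c * V c + G a c * dV d c)) = A1 + A3 - A2 - A4.
  rewrite /A1 /A2 /A3 /A4 -big_split -!sumrB; apply: eq_bigr => a _.
  rewrite -big_split -!sumrB mulr_sumr; apply: eq_bigr => c _ /=.
  by rewrite (dG_sym a d c); ring.
have -> : \sum_a \sum_b (dG d a b * V a * V b + G a b * dV d a * V b +
    G a b * V a * dV d b) = A2 + A4 + A4.
  have A4' : A4 = \sum_a \sum_b G a b * dV d a * V b.
    rewrite /A4 exchange_big /=; apply: eq_bigr => a _; apply: eq_bigr => b _.
    by rewrite (G_sym b a); ring.
  rewrite {1}A4' /A2 /A4 -!big_split; apply: eq_bigr => a _ /=.
  by rewrite -!big_split.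
move: (\sum_c _) (A1) A2 A3 A4 (df d) => L x y u w f H.
by lra.
Qed.

End CovariantMomentum.

Lemma near_bounded (R : realType) (U : normedModType R) (J : finType)
    (f : J -> U -> R^o) (x : U) : (forall j, {for x, continuous (f j)}) ->
  exists2 M : R, 0 <= M & nbhs x (fun y => forall j, `|f j y| <= M).
Proof.
move=> fc; exists (\sum_j (`|f j x| + 1)); first by apply: sumr_ge0 => j _; rewrite addr_ge0.
apply: (@filter_forall _ _ (fun j y => `|f j y| <= _) (nbhs x)) => j.
have := fc j; move/cvgrPdist_le => /(_ _ (ltr01)); apply: filterS => y fy.
rewrite (bigD1 j)//= (@le_trans _ _ (`|f j x| + 1))//; last first.
  by rewrite lerDl sumr_ge0// => k _; rewrite addr_ge0.
rewrite -lerBlDl; apply: le_trans fy; rewrite distrC; exact: lerB_dist.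
Qed.

(** * Transport of the vorticity in a chart *)

Section Vorticity.
Context {R : realType} {n : nat}.
Notation RV := (R^o * 'rV[R]_n)%type.
Variables (I : set R) (D : set 'rV[R]_n).
Let E : set RV := (I : set R^o) `*` D.
Hypotheses (oI : open I) (oD : open D).

Definition tdir : RV := (1, 0).
Definition xdir (a : 'I_n) : RV := (0, delta_mx 0 a).
Notation dt f := ('D_tdir f).
Notation dx a f := ('D_(xdir a) f).

Lemma xdir_sum (c : 'I_n -> R) : \sum_a c a *: xdir a = ((0, \row_a c a) : RV).
Proof.
rewrite [\row_a _]row_sum_delta.
elim: (index_enum _) => [|a r IH]; first by rewrite !big_nil.
rewrite !big_cons IH mxE; congr pair => /=.
by rewrite scaler0 addr0.
Qed.

Variables (V alpha : 'I_n -> RV -> R^o) (F : RV -> R^o).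
Hypotheses (smooth_V : forall a, smooth_on E (V a))
  (smooth_alpha : forall a, smooth_on E (alpha a)) (smooth_F : smooth_on E F).

Definition vort (e d : 'I_n) (z : RV) : R^o := dx e (alpha d) z - dx d (alpha e) z.

Hypothesis momentum : forall z d, E z ->
  dt (alpha d) z = - (\sum_a V a z * vort a d z) - dx d F z.

Lemma open_spacetime : open E.
Proof.
rewrite openE => -[t x] [/= It Dx].
by exists (I, D) => //=; split; [exact: (open_nbhs_nbhs (conj oI It))|
  exact: (open_nbhs_nbhs (conj oD Dx))].
Qed.

Let oE := open_spacetime.

Lemma smooth_derive (W : normedModType R) (U : set RV) (f : RV -> W) u :
  smooth_on U f -> smooth_on U ('D_u f).
Proof. by move=> sf k; exact: Ck_derive (sf k.+1). Qed.

Lemma smooth_derive_comm (f : RV -> R^o) z u w : smooth_on E f -> E z ->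
  'D_w ('D_u f) z = 'D_u ('D_w f) z.
Proof. by move=> sf Ez; exact: (Ck_derive_comm u w oE (sf 2) Ez). Qed.

Lemma smooth_vort e d : smooth_on E (vort e d).
Proof.
by move=> k; apply: (CkB oE); exact: smooth_derive.
Qed.

Lemma smooth_on_derivable (f : RV -> R^o) z u : smooth_on E f -> E z -> derivable f z u.
Proof. by move=> sf Ez; exact: (Ck_derivable (sf 1) Ez). Qed.

Let vortE z e d u : E z ->
  'D_u (vort e d) z = 'D_u (dx e (alpha d)) z - 'D_u (dx d (alpha e)) z.
Proof.
by move=> Ez; rewrite deriveB//; apply: smooth_on_derivable => //; exact: smooth_derive.
Qed.

Let dx_momentum z e d : E z ->
  dx e (dt (alpha d)) z =
    - (\sum_a (dx e (V a) z * vort a d z + V a z * dx e (vort a d) z))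
    - dx e (dx d F) z.
Proof.
move=> Ez.
have -> : dx e (dt (alpha d)) z =
    dx e (fun z => - (\sum_a V a z * vort a d z) - dx d F z : R^o) z.
  apply: near_eq_derive; apply: filterS (open_nbhs_nbhs (conj oE Ez)) => y.
  exact: momentum.
have sumd : is_derive z (xdir e) (fun z => \sum_a V a z * vort a d z : R^o)
    (\sum_a (dx e (V a) z * vort a d z + V a z * dx e (vort a d) z) : R^o).
  apply: is_derive_sumr => a.
  have dVa := derivableP (smooth_on_derivable (u := xdir e) (smooth_V a) Ez).
  have dva := derivableP (smooth_on_derivable (u := xdir e) (@smooth_vort a d) Ez).
  by apply: (is_derive_eq (is_deriveM dVa dva)); rewrite addrC [_ *: 'D_ _ (V a) _]mulrC.
have dF := derivableP (smooth_on_derivable (u := xdir e) (smooth_derive (xdir d) smooth_F) Ez).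
exact: (derive_val (is_derive := is_deriveB (is_deriveN sumd) dF)).
Qed.

(** This is $\partial_t \omega + \mathcal{L}_v \omega = 0$ in components. Antisymmetrising the space
    derivatives of the momentum equation removes [F], and closedness of $\omega$ turns the remaining
    derivatives of $\omega$ into its derivative along [V]. *)
Lemma vort_transport z e d : E z ->
  'D_((1, \row_a V a z) : RV) (vort e d) z =
    \sum_a (dx d (V a) z * vort a e z - dx e (V a) z * vort a d z).
Proof.
move=> Ez.
have -> : ((1, \row_a V a z) : RV) = tdir + \sum_a V a z *: xdir a.
  rewrite (@xdir_sum (fun a => V a z)).
  by congr pair; rewrite /= ?addr0 ?add0r.
rewrite (Ck_derive_dirD _ _ oE (@smooth_vort e d 1) Ez).
rewrite (Ck_derive_dir_sum _ _ _ oE (@smooth_vort e d 1) Ez).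
have dt_vort : dt (vort e d) z = dx e (dt (alpha d)) z - dx d (dt (alpha e)) z.
  rewrite (vortE _ _ _ Ez) -(smooth_derive_comm tdir (xdir e) (smooth_alpha d) Ez).
  by rewrite -(smooth_derive_comm tdir (xdir d) (smooth_alpha e) Ez).
have ddF := smooth_derive_comm (xdir d) (xdir e) smooth_F Ez.
pose v a b := vort a b z.
pose dv c a b := dx c (vort a b) z; pose dV c a := dx c (V a) z; pose W a := V a z.
(* The identity $d(d\alpha) = 0$, by three exchanges of mixed derivatives. *)
have closed a : dv a e d = dv e a d - dv d a e.
  pose P a b c := dx a (dx b (alpha c)) z.
  have comm a' b c : P a' b c = P b a' c.
    exact: (smooth_derive_comm (xdir b) (xdir a') (smooth_alpha c) Ez).
  have dvE c a' b : dv c a' b = P c a' b - P c b a' by exact: vortE.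
  rewrite !dvE (comm e a d) (comm d a e) (comm d e a); clear; move: P => P.
  by rewrite opprB addrA addrAC [X in _ = X + _]addrAC subrK.
have mom e' d' : dx e' (dt (alpha d')) z =
    - (\sum_a (dV e' a * v a d' + W a * dv e' a d')) - dx e' (dx d' F) z.
  exact: dx_momentum.
rewrite dt_vort !mom ddF.
transitivity (\sum_a (dV d a * v a e - dV e a * v a d)); last by [].
have key (x y c u : R) (w : R) : - x + y + c = w -> - x - u - (- y - u) + c = w.
  by move=> <-; ring.
apply: key.
transitivity (- (\sum_a (dV e a * v a d + W a * dv e a d)) +
  \sum_a (dV d a * v a e + W a * dv d a e) + \sum_a W a * dv a e d); first by [].
rewrite -sumrN -!big_split; apply: eq_bigr => a _ /=.
rewrite closed; move: (W a) (dv e a d) (dv d a e) (dV e a) (dV d a) (v a d) (v a e) => *; ring.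
Qed.

End Vorticity.

Lemma sum_delta (R : pzRingType) (n : nat) (x : 'I_n -> R) (e : 'I_n) :
  \sum_b (b == e)%:R * x b = x e.
Proof.
rewrite (bigD1 e)//= eqxx mul1r big1 ?addr0// => b /negPf ->; exact: mul0r.
Qed.

(** * Propagation of a potential near one time slice *)

Section PotentialPropagation.
Context {R : realType} {n : nat}.
Notation RV := (R^o * 'rV[R]_n)%type.
Notation dt f := ('D_tdir f).
Notation dx a f := ('D_(xdir a) f).
Variables (I : set R) (D : set 'rV[R]_n).
Let E : set RV := (I : set R^o) `*` D.
Hypotheses (oI : open I) (oD : open D).
Let oE : open E := open_spacetime oI oD.

Lemma slice_affine (s : R^o) (h : R) (u x : 'rV[R]_n) :
  ((s, h *: u + x) : RV) = h *: ((0, u) : RV) + (s, x).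
Proof. by congr pair; rewrite /= scaler0 add0r. Qed.

Lemma derive_slice (f : RV -> R^o) (s : R^o) (x u : 'rV[R]_n) :
  'D_u (fun y => f (s, y)) x = 'D_((0, u) : RV) f (s, x).
Proof.
exact: (derive_affine (L := fun y => (s, y) : RV) (l := fun y => (0, y) : RV)
  (slice_affine s)).
Qed.

Variables (V alpha : 'I_n -> RV -> R^o) (F theta : RV -> R^o).
Hypotheses (smooth_V : forall a, smooth_on E (V a))
  (smooth_alpha : forall a, smooth_on E (alpha a)) (smooth_F : smooth_on E F)
  (smooth_theta : smooth_on E theta).
Hypothesis momentum : forall z d, E z ->
  dt (alpha d) z = - (\sum_a V a z * vort alpha a d z) - dx d F z.
Hypothesis theta_dt : forall z, E z -> dt theta z = - F z.
Variable s : R.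
Hypothesis Is : I s.
Hypothesis alpha_s : forall x d, D x -> alpha d (s, x) = dx d theta (s, x).

(** The covector field is known to be a differential only on the slice at time [s]. The vorticity
    involves space derivatives alone, so it can be computed on that slice, where mixed derivatives
    of [theta] cancel. *)
Let vort_s x e d : D x -> vort alpha e d (s, x) = 0.
Proof.
have dxs a b y : D y -> dx a (alpha b) (s, y) = dx a (dx b theta) (s, y).
  move=> Dy; rewrite -!derive_slice; apply: near_eq_derive.
  by apply: filterS (open_nbhs_nbhs (conj oD Dy)) => y'; exact: alpha_s.
move=> Dx; have Es : E (s, x) by [].
rewrite /vort !dxs//.
by rewrite (smooth_derive_comm oI oD (xdir d) (xdir e) smooth_theta Es) subrr.
Qed.

Lemma vort_propagates x0 : D x0 ->
  nbhs ((s, x0) : RV) (fun z => forall e d, vort alpha e d z = 0).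
Proof.
move=> Dx0; have Es : E (s, x0) by [].
pose J := ('I_n * 'I_n)%type.
pose w (j : J) := vort alpha j.1 j.2.
pose vel (z : RV) : 'rV[R]_n := \row_a V a z.
(* The Kronecker factors select from all pairs [k] the components with second index [j.1] or [j.2],
   which are those on the right of [vort_transport]. *)
pose B (j k : J) (z : RV) : R :=
  (k.2 == j.1)%:R * dx j.2 (V k.1) z - (k.2 == j.2)%:R * dx j.1 (V k.1) z.
have cV a z : E z -> {for z, continuous (V a)}.
  by move=> Ez; exact: (Ck_continuous (smooth_V a 0) Ez).
have cdV (j : J) z : E z -> {for z, continuous (dx j.1 (V j.2))}.
  by move=> Ez; exact: (Ck_continuous (@smooth_derive _ _ _ _ _ (xdir j.1) (smooth_V j.2) 0) Ez).
have [M1 M1_ge0 nM1] := near_bounded (fun a => cV a _ Es).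
have [M2 M2_ge0 nM2] := near_bounded (fun j => cdV j _ Es).
have nE : nbhs ((s, x0) : RV) E by exact: (open_nbhs_nbhs (conj oE Es)).
have H := @transport_zero R n J w vel B s x0 (M2 + M2) M1.
suff : nbhs ((s, x0) : RV) (fun z => forall j, w j z = 0).
  by apply: filterS => z H' e d; exact: (H' (e, d)).
apply: H; last first.
  by apply: filterS (open_nbhs_nbhs (conj oD Dx0)) => x Dx j; exact: vort_s.
apply: (nbhs_and_sub nE (nbhs_and_sub nM1 nM2 (fun z => @conj _ _))) => z Ez [V1 V2].
split.
- by move=> j; exact: (Ck_continuous (@smooth_vort _ _ _ _ oI oD _ smooth_alpha j.1 j.2 0) Ez).
- move=> [e d]; apply: DeriveDef.
    exact: (smooth_on_derivable (@smooth_vort _ _ _ _ oI oD _ smooth_alpha e d) Ez).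
  rewrite (vort_transport oI oD smooth_V smooth_alpha smooth_F momentum)//.
  rewrite [RHS](eq_bigr (fun k : J => B (e, d) (k.1, k.2) z * w (k.1, k.2) z)); last first.
    by case.
  rewrite -(pair_bigA _ (fun a b => B (e, d) (a, b) z * w (a, b) z)) /=.
  apply: eq_bigr => a _; rewrite /B /w /=.
  under eq_bigr do rewrite mulrBl -!mulrA.
  by rewrite sumrB !sum_delta.
- move=> j k; rewrite /B (le_trans (ler_normB _ _))// lerD// normrM.
    by case: eqP => _; rewrite ?normr1 ?normr0 ?mul1r ?mul0r//; exact: (V2 (j.2, k.1)).
  by case: eqP => _; rewrite ?normr1 ?normr0 ?mul1r ?mul0r//; exact: (V2 (j.1, k.1)).
- rewrite [leLHS]/Num.Def.normr/= mx_normrE.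
  by apply: bigmax_le => // -[i a] _; rewrite /= mxE.
Qed.

(** Without vorticity the momentum equation reads $\partial_t \alpha_d = -\partial_d F$, and
    exchanging derivatives gives the same value for $\partial_t \partial_d \theta$. *)
Let dt_defect z d : E z -> (forall e d, vort alpha e d z = 0) ->
  is_derive z tdir (fun y => alpha d y - dx d theta y : R^o) 0.
Proof.
move=> Ez v0.
have da := derivableP (smooth_on_derivable (u := tdir) (smooth_alpha d) Ez).
have dt := derivableP (smooth_on_derivable (u := tdir)
  (@smooth_derive _ _ _ _ _ (xdir d) smooth_theta) Ez).
apply: (is_derive_eq (is_deriveB da dt)).
rewrite (smooth_derive_comm oI oD (xdir d) tdir smooth_theta Ez).
have -> : dx d ('D_tdir theta) z = dx d (- F) z.
  by apply: near_eq_derive; apply: filterS (open_nbhs_nbhs (conj oE Ez)) => y /theta_dt.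
rewrite deriveN; last exact: (smooth_on_derivable smooth_F Ez).
rewrite momentum// big1 ?oppr0 ?add0r ?subrr// => a _.
by rewrite v0 mulr0.
Qed.

(** On a ball free of vorticity the defect has zero time derivative. A ball of the product is a
    product of balls, so it contains the time segment from [(s, x)] to [(t, x)], along which the
    mean value theorem carries the value 0. *)
Lemma potential_propagates x0 : D x0 ->
  nbhs ((s, x0) : RV) (fun z => forall d, alpha d z = dx d theta z).
Proof.
move=> Dx0; have Es : E (s, x0) by [].
have nE : nbhs ((s, x0) : RV) E by exact: (open_nbhs_nbhs (conj oE Es)).
have := nbhs_and_sub nE (vort_propagates Dx0) (fun z => @conj _ _).
move=> /nbhs_ballP[r /= r_gt0 rP]; apply/nbhs_ballP; exists r => //= -[t x].
move=> -[/= st xr] d; pose beta : RV -> R^o := fun y => alpha d y - dx d theta y.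
have seg (k : R) : 0 <= k <= 1 -> let y := k *: ((t - s) *: tdir) + ((s, x) : RV) in
    E y /\ (forall e d, vort alpha e d y = 0).
  move=> /andP[k0 k1] y; apply: rP.
  have -> : y = ((k * (t - s) + s, x) : RV).
    by congr pair; rewrite /= ?scaler0 ?add0r// /GRing.scale /= mulr1.
  split => //=; move: st; rewrite -!ball_normE /= => st.
  rewrite opprD addrCA subrr addr0 normrN normrM (ger0_norm k0) distrC.
  by apply: le_lt_trans st; rewrite ler_piMl.
have [k /seg[Ey v0]|k /andP[/ltW k0 /ltW k1]] :=
    @MVT_direction R _ beta ((t - s) *: tdir) ((s, x) : RV).
  have [D1 _] := dt_defect d Ey v0.
  exact: (ex_derive (is_derive := is_derive_dirZ (t - s) D1)).
have [Ey v0] := seg k (introT andP (conj k0 k1)).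
have [D1 D1E] := dt_defect d Ey v0.
rewrite (derive_val (is_derive := is_derive_dirZ (t - s) D1)) D1E scaler0.
have -> : (t - s) *: tdir + ((s, x) : RV) = ((t, x) : RV).
  by congr pair; rewrite /= ?scaler0 ?add0r// /GRing.scale /= mulr1 subrK.
have k01 : 0 <= (0 : R) <= 1 by rewrite lexx ler01.
have := seg 0 k01; rewrite scale0r add0r => -[[_ Dx] _].
by rewrite /beta (alpha_s d Dx) subrr subr0 => /eqP; rewrite subr_eq0 => /eqP.
Qed.

End PotentialPropagation.

(** * Gradients and charts *)

(* [coord] alone now means the coordinates of a vector in a basis (vector.v). *)
Local Notation coord := Defs.coord.

Section Charts.
Context {R : realType} {n : nat} {M : oriented_manifold R n}.
Implicit Types (i j : chart_index M) (p : M).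

Definition chart_img i : set 'rV[R]_n := coord i @` dom i.

Lemma chart_img_is_open i : open (chart_img i).
Proof. exact: chart_img_open. Qed.

Lemma dom_open i : open (dom i).
Proof. exact: chart_dom_open. Qed.

Lemma coordK i p : dom i p -> param i (coord i p) = p.
Proof. exact: chart_mapK. Qed.

Lemma coord_img i p : dom i p -> chart_img i (coord i p).
Proof. by move=> ip; exists p. Qed.

Lemma param_dom i x : chart_img i x -> dom i (param i x).
Proof. by move=> [p ip <-]; rewrite coordK. Qed.

Lemma paramK i x : chart_img i x -> coord i (param i x) = x.
Proof. by move=> [p ip <-]; rewrite coordK. Qed.

Lemma partial_param i a (f : M -> R) x : chart_img i x ->
  partial i a f (param i x) = 'D_(delta_mx 0 a) (f \o param i : _ -> R^o) x.
Proof. by move=> ix; rewrite /partial paramK. Qed.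

Lemma transition_unit i j p : dom i p -> dom j p ->
  transition_jacobian i j p \in unitmx.
Proof. by move=> ip jp; rewrite unitmxE unitfE gt_eqF//; exact: atlas_oriented. Qed.

(** A row annihilated by the metric has zero squared length, hence is zero by positivity. *)
Lemma metric_unit (g : riemannian_metric M) i p : dom i p -> g i p \in unitmx.
Proof.
move=> ip; rewrite -row_free_unit -kermx_eq0; apply/rowV0P => x /sub_kermxP xg.
apply/eqP/negPn/negP => x0; have := metric_pos g ip x0.
by rewrite xg mul0mx mxE ltxx.
Qed.

(** Near the point, the expression of [f] in chart [i] is its expression in chart [j] composed with
    the transition map; both are Frechet differentiable, so the chain rule applies. *)
Lemma partial_change i j p (f : M -> R) a : smooth_fun f -> dom i p -> dom j p ->
  partial i a f p = \sum_b transition_jacobian i j p a b * partial j b f p.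
Proof.
move=> sf ip jp.
pose phi := coord j \o param i; pose x := coord i p.
pose Dij := chart_map (atlas i) @` (chart_dom (atlas i) `&` chart_dom (atlas j)).
have xij : Dij x by exists p.
have oDij : open Dij.
  (* The overlap is open as a preimage of [dom j] under the continuous inverse of chart [i]. *)
  rewrite (_ : Dij = chart_img i `&` param i @^-1` dom j).
    rewrite openE => y [iy jy]; apply: filterI.
      exact: (open_nbhs_nbhs (conj (@chart_img_is_open i) iy)).
    have [q iq qy] := iy; have := @chart_inv_continuous _ _ _ (atlas i) q iq.
    rewrite -[chart_map _ _]/(coord i q) qy => c; apply: c.
    exact: (open_nbhs_nbhs (conj (@dom_open j) jy)).
  apply/seteqP; split => [y [q [iq jq] <-]|y [[q iq <-]]].
    by split; [exact: coord_img|rewrite /= coordK].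
  by rewrite /= coordK// => jq; exists q.
have dphi : differentiable phi x.
  exact: (Ck_differentiable_rV oDij (atlas_smooth i j 1) xij).
have phix : phi x = coord j p by rewrite /phi /= coordK.
pose fj : 'rV[R]_n -> R^o := f \o param j.
have dfj : differentiable fj (phi x).
  rewrite phix; exact: (Ck_differentiable (@chart_img_is_open j) (sf j 1) (coord_img jp)).
transitivity ('D_(delta_mx 0 a) (fj \o phi) x).
  rewrite /partial; apply: near_eq_derive.
  apply: filterS (open_nbhs_nbhs (conj oDij xij)) => y [q [iq jq] <-].
  by rewrite /fj /phi /= [param i _]coordK// coordK.
have dphiE : 'd phi x (delta_mx 0 a) = delta_mx 0 a *m transition_jacobian i j p.
  by rewrite -deriveE// deriveEjacobian.
rewrite deriveE; last exact: differentiable_comp.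
rewrite diff_comp//= dphiE -rowE {1}[row _ _]row_sum_delta linear_sum.
apply: eq_bigr => b _; rewrite linearZ /= -deriveE// phix.
by rewrite mxE.
Qed.

End Charts.

Section Gradients.
Context {R : realType} {n : nat} {M : oriented_manifold R n}.
Variable g : riemannian_metric M.
Implicit Types (i j : chart_index M) (p : M).

(** Lowering the index trades the inverse metric for a linear equation, the form in which gradients
    are compared below. *)
Lemma gradP i p (f : M -> R) (X : 'rV[R]_n) : dom i p ->
  X = grad g f i p <-> X *m g i p = \row_a partial i a f p.
Proof.
move=> ip; have gu := metric_unit g ip; split=> [->|E].
  by rewrite /grad mulmxKV.
by rewrite /grad -E mulmxK.
Qed.

(** Partial derivatives change by [J^T] and the metric by [J] and [J^T] on either side; cancelling
    the invertible [J^T] leaves the law for components. *)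
Lemma grad_vector_field (f : M -> R) : smooth_fun f -> vector_field (grad g f).
Proof.
move=> sf i j p ip jp; apply/esym/gradP => //.
set J := transition_jacobian i j p.
have JTu : J^T \in unitmx by rewrite unitmx_tr; exact: transition_unit.
have rowE : (\row_a partial j a f p) *m J^T = \row_a partial i a f p.
  apply/rowP => a; rewrite !mxE (partial_change a sf ip jp).
  by apply: eq_bigr => b _; rewrite !mxE mulrC.
apply: (can_inj (mulmxK JTu)); rewrite rowE -((gradP f _ ip).1 erefl).
by rewrite (metric_tensor g ip jp) !mulmxA.
Qed.

Lemma sqnorm_change (X : chart_index M -> M -> 'rV[R]_n) i j p :
  vector_field X -> dom i p -> dom j p -> sqnorm g X i p = sqnorm g X j p.
Proof.
move=> vX ip jp; rewrite /sqnorm (vX i j p ip jp) (metric_tensor g ip jp).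
by rewrite trmx_mul !mulmxA.
Qed.

End Gradients.

(** * Slices of functions on spacetime *)

Section Slices.
Context {R : realType} {n : nat} {M : oriented_manifold R n}.
Variable I : set R.

Lemma smooth_fun_slice (f : R -> M -> R) t :
  I t -> smooth_fun_on I f -> smooth_fun (f t).
Proof.
move=> It sf i k.
have c : continuous (fun x : 'rV[R]_n => (t, x) : (R^o * 'rV[R]_n)%type).
  move=> x; exact: (@cvg_pair _ _ _ _ (nbhs (t : R^o)) (nbhs x) _ _ _ _ _
    (cvg_cst (t : R^o)) cvg_id).
have := @Ck_affine _ _ _ _ _ _ (@slice_affine R n t) k _ _ c (sf i k).
by apply: Ck_sub => x ix.
Qed.

Lemma Ck_snd (W : normedModType R) k (D : set 'rV[R]_n) (f : 'rV[R]_n -> W) :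
  Ck k D f -> Ck k ((I : set R^o) `*` D) (fun z : (R^o * 'rV[R]_n)%type => f z.2).
Proof.
move=> fk.
have c : continuous (snd : (R^o * 'rV[R]_n)%type -> 'rV[R]_n).
  by move=> x; exact: cvg_snd.
have := @Ck_affine _ _ _ _ snd snd (fun h u x => erefl) k _ _ c fk.
by apply: Ck_sub => -[t x] [].
Qed.

Lemma time_affine (x : 'rV[R]_n) (h : R) (u t : R^o) :
  ((h *: u + t, x) : (R^o * 'rV[R]_n)%type) = h *: ((u, 0) : (R^o * 'rV[R]_n)%type) + (t, x).
Proof. by congr pair; rewrite /= scaler0 add0r. Qed.

Lemma derive1_time (W : normedModType R) (f : (R^o * 'rV[R]_n)%type -> W) (t : R) x :
  derive1 (fun s => f (s, x)) t = 'D_tdir f (t, x).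
Proof.
rewrite derive1E.
exact: (derive_affine (L := fun s : R^o => (s, x) : (R^o * 'rV[R]_n)%type)
  (l := fun s : R^o => (s, 0) : (R^o * 'rV[R]_n)%type) (@time_affine x)).
Qed.

End Slices.

(** * The potential of the flow *)

Lemma Ck_fst (R : realType) (V : normedModType R) k :
  Ck k setT (fun z : (R^o * V)%type => z.1 : R^o).
Proof.
have id_k : Ck k setT (idfun : R^o -> R^o).
  case: k => [|k]; first by split=> // x _; exact: cvg_id.
  split=> [x _|x]; first exact: cvg_id.
  split=> [y _|]; first exact: derivable_id.
  rewrite (_ : (fun y => _) = cst x); first exact: Ck_cst.
  by apply/funext => y; exact: derive_id.
have c : continuous (fst : (R^o * V)%type -> R^o) by move=> x; exact: cvg_fst.
exact: (@Ck_affine _ _ _ _ fst fst (fun h u x => erefl) k _ _ c id_k).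
Qed.

Section Flow.
Context {R : realType} {n : nat} {M : oriented_manifold R n}.
Notation RV := (R^o * 'rV[R]_n)%type.
Variables (g : riemannian_metric M) (I : set R).
Hypothesis I_open : open I.
Variables (v : R -> chart_index M -> M -> 'rV[R]_n) (u : R -> M -> R).
Hypothesis v_field : forall t, I t -> vector_field (v t).
Hypothesis v_smooth : smooth_comp_on I v.
Hypothesis u_smooth : smooth_fun_on I u.
Hypothesis v_eq : forall t i p, I t -> dom i p ->
  derive1 (fun s => v s i p) t + nabla g (v t) (v t) i p + grad g (u t) i p = 0.
Implicit Types (i j : chart_index M) (p : M) (z : RV).

(** A function on [M] needs a value independent of charts, so some chart around [p] is picked;
    invariance of the squared norm makes the choice immaterial at times in [I]. *)
Definition bernoulli (t : R) (p : M) : R :=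
  2^-1 * sqnorm g (v t) (projT1 (cid (atlas_cover p))) p + u t p.

Lemma bernoulliE t i p : I t -> dom i p ->
  bernoulli t p = 2^-1 * sqnorm g (v t) i p + u t p.
Proof.
move=> It ip; rewrite /bernoulli; case: cid => j /= jp.
by rewrite (sqnorm_change g (v_field It) jp ip).
Qed.

Section InChart.
Variable i : chart_index M.
Let E : set RV := (I : set R^o) `*` chart_img i.
Let oE : open E := open_spacetime I_open (@chart_img_is_open _ _ _ i).
Let V a z : R^o := v z.1 i (param i z.2) 0 a.
Let G a b (x : 'rV[R]_n) : R^o := g i (param i x) a b.
Let f z : R^o := u z.1 (param i z.2).

Definition chart_covector (d : 'I_n) (z : RV) : R^o := \sum_c G d c z.2 * V c z.
Definition chart_bernoulli (z : RV) : R^o := bernoulli z.1 (param i z.2).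

Lemma smooth_velocity a : smooth_on E (V a).
Proof. by move=> k; apply: (Ck_mx _ _ oE); exact: v_smooth. Qed.

Let smooth_G a b : smooth_on (chart_img i) (G a b).
Proof. by move=> k; apply: (Ck_mx _ _ (@chart_img_is_open _ _ _ i)); exact: metric_smooth. Qed.

Let smooth_Gs a b : smooth_on E (fun z => G a b z.2).
Proof. by move=> k; apply: Ck_snd; exact: smooth_G. Qed.

Let smooth_f : smooth_on E f.
Proof. exact: u_smooth. Qed.

Lemma smooth_chart_covector d : smooth_on E (chart_covector d).
Proof.
move=> k; apply: (Ck_sum _ _ oE) => c.
by apply: (CkM oE); [exact: smooth_Gs|exact: smooth_velocity].
Qed.

Lemma chart_bernoulliE z : E z -> chart_bernoulli z =
  2^-1 * (\sum_a \sum_b G a b z.2 * V a z * V b z) + f z.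
Proof.
move=> [It ix]; rewrite /chart_bernoulli (bernoulliE It (param_dom ix)).
congr (_ * _ + _); rewrite /sqnorm mxE exchange_big /=.
apply: eq_bigr => b _; rewrite !mxE mulr_suml; apply: eq_bigr => a _.
by rewrite /V /G [_ * g _ _ _ _]mulrC.
Qed.

Lemma smooth_chart_bernoulli : smooth_on E chart_bernoulli.
Proof.
move=> k; apply: (@Ck_ext _ _ _ _ _ (fun z => 2^-1 *
  (\sum_a \sum_b G a b z.2 * V a z * V b z) + f z : R^o)) => //.
  by move=> z Ez; rewrite chart_bernoulliE.
apply: (CkD oE) (smooth_f k); apply: (CkM oE); first exact: Ck_cst.
do 2!apply: (Ck_sum _ _ oE) => ?; apply: (CkM oE); last exact: smooth_velocity.
by apply: (CkM oE); [exact: smooth_Gs|exact: smooth_velocity].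
Qed.

Let derive_Gs w a b z : E z ->
  is_derive z w (fun z => G a b z.2 : R^o) ('D_(w.2) (G a b) z.2).
Proof.
move=> [_ ix].
have L (h : R) (x y : RV) : (h *: x + y).2 = h *: x.2 + y.2 by [].
apply: DeriveDef; last exact: (derive_affine L (G a b)).
by apply: (derivable_affine (f := G a b) L); exact: (Ck_derivable (smooth_G a b 1) ix).
Qed.

Let derive_V w a z : E z -> is_derive z w (V a) ('D_w (V a) z).
Proof.
by move=> Ez; apply: derivableP; exact: (smooth_on_derivable (@smooth_velocity a) Ez).
Qed.

Let derive_covector w d z : E z -> 'D_w (chart_covector d) z =
  \sum_c ('D_(w.2) (G d c) z.2 * V c z + G d c z.2 * 'D_w (V c) z).
Proof.
move=> Ez; apply: derive_val; apply: is_derive_sumr => c.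
apply: (is_derive_eq (is_deriveM (derive_Gs w d c Ez) (derive_V w c Ez))).
by rewrite addrC [_ *: 'D_ _ (G d c) _]mulrC.
Qed.

Let derive_bernoulli d z : E z -> 'D_(xdir d) chart_bernoulli z =
  2^-1 * \sum_a \sum_b ('D_(delta_mx 0 d) (G a b) z.2 * V a z * V b z
    + G a b z.2 * 'D_(xdir d) (V a) z * V b z
    + G a b z.2 * V a z * 'D_(xdir d) (V b) z) + 'D_(xdir d) f z.
Proof.
move=> Ez; set K := fun z => 2^-1 * (\sum_a \sum_b G a b z.2 * V a z * V b z) + f z : R^o.
have -> : 'D_(xdir d) chart_bernoulli z = 'D_(xdir d) K z.
  by apply: near_eq_derive; apply: filterS (open_nbhs_nbhs (conj oE Ez)) => y;
    exact: chart_bernoulliE.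
apply: derive_val; apply: is_deriveD; last first.
  by apply: derivableP; exact: (smooth_on_derivable smooth_f Ez).
apply: is_deriveZ; apply: is_derive_sumr => a; apply: is_derive_sumr => b.
have dG : is_derive z (xdir d) (fun z => G a b z.2 : R^o)
    ('D_(delta_mx 0 d) (G a b) z.2) by exact: derive_Gs.
have dVa := derive_V (xdir d) a Ez; have dVb := derive_V (xdir d) b Ez.
apply: (is_derive_eq (is_deriveM (is_deriveM dG dVa) dVb)).
transitivity (G a b z.2 * V a z * 'D_(xdir d) (V b) z + V b z *
  (G a b z.2 * 'D_(xdir d) (V a) z + V a z * 'D_(delta_mx 0 d) (G a b) z.2)); first by [].
move: (G a b z.2) (V a z) (V b z) ('D_(delta_mx 0 d) (G a b) z.2).
move: ('D_(xdir d) (V a) z) ('D_(xdir d) (V b) z).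
by move=> *; ring.
Qed.

Lemma chart_momentum z d : E z -> 'D_tdir (chart_covector d) z =
  - (\sum_a V a z * vort chart_covector a d z) - 'D_(xdir d) chart_bernoulli z.
Proof.
move=> Ez; have [It ix] := Ez; have ip := param_dom ix.
have dt_cov : 'D_tdir (chart_covector d) z = \sum_c G d c z.2 * 'D_tdir (V c) z.
  rewrite derive_covector//; apply: eq_bigr => c _.
  (* The metric does not depend on time: the space part of [tdir] is 0. *)
  have -> : 'D_(tdir.2) (G d c) z.2 = 0 by exact: derive0.
  by rewrite mul0r add0r.
rewrite derive_bernoulli// dt_cov.
under [X in _ = - X - _]eq_bigr do rewrite /vort !derive_covector//.
apply: (@covariant_momentum R n (g i (param i z.2))
  (fun a b c => 'D_(delta_mx 0 a) (G b c) z.2) (fun a => V a z)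
  (fun c => 'D_tdir (V c) z) (fun d => 'D_(xdir d) f z)
  (fun a c => 'D_(xdir a) (V c) z)).
- by move=> a b; rewrite -{1}(Defs.metric_sym g ip) mxE.
- move=> a b c; apply: near_eq_derive.
  apply: filterS (open_nbhs_nbhs (conj (@chart_img_is_open _ _ _ i) ix)) => y iy.
  by rewrite /G -{1}(Defs.metric_sym g (param_dom iy)) mxE.
- exact: metric_unit.
move=> c; pose p := param i z.2; pose t : R := z.1.
have zE : z = (t, z.2) by rewrite /t -surjective_pairing.
have partialE a (h : RV -> R^o) :
    'D_(delta_mx 0 a) (fun y => h (t, y)) z.2 = 'D_(xdir a) h z.
  by rewrite derive_slice -zE.
have e1 : (derive1 (fun s => v s i p) t) 0 c = 'D_tdir (V c) z.
  rewrite (@derive1_time _ _ _ (fun y : RV => v y.1 i (param i y.2))) -zE.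
  by rewrite derive_mx ?mxE//; exact: (Ck_derivable (@v_smooth i 1) Ez).
have chrE a b : christoffel g i p c a b = 2^-1 * \sum_d invmx (g i p) c d *
    ('D_(delta_mx 0 a) (G b d) z.2 + 'D_(delta_mx 0 b) (G a d) z.2 -
     'D_(delta_mx 0 d) (G a b) z.2).
  by rewrite /christoffel /partial /p paramK.
have e2 : nabla g (v t) (v t) i p 0 c = \sum_a V a z * 'D_(xdir a) (V c) z +
    \sum_a \sum_b (2^-1 * \sum_d invmx (g i p) c d *
      ('D_(delta_mx 0 a) (G b d) z.2 + 'D_(delta_mx 0 b) (G a d) z.2 -
       'D_(delta_mx 0 d) (G a b) z.2)) * V a z * V b z.
  rewrite mxE; congr (_ + _).
    by apply: eq_bigr => a _; rewrite -partialE /partial /p paramK.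
  by apply: eq_bigr => a _; apply: eq_bigr => b _; rewrite chrE.
have e3 : grad g (u t) i p 0 c = \sum_e 'D_(xdir e) f z * invmx (g i p) e c.
  rewrite mxE; apply: eq_bigr => e _; rewrite mxE; congr (_ * _).
  by rewrite -partialE /partial /p paramK.
have H : (derive1 (fun s => v s i p) t + nabla g (v t) (v t) i p +
  grad g (u t) i p) 0 c = 0 by rewrite v_eq// mxE.
by move: H; rewrite mxE [X in X + _]mxE e1 e2 e3.
Qed.

End InChart.

(** * The candidate potential on the whole manifold *)

Variables (t0 : R) (f0 : M -> R).
Hypotheses (I_interval : is_interval I) (It0 : I t0) (f0_smooth : smooth_fun f0).

(** Writing the time integral as [t - t0] times an average over $[0,1]$ treats times before and
    after [t0] alike and matches [tavg] in every chart. *)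
Definition potential (t : R) (p : M) : R :=
  f0 p - (t - t0) * int01 (fun r => bernoulli (t0 + r * (t - t0)) p).

Definition chart_potential i (z : RV) : R^o := potential z.1 (param i z.2).

Lemma chart_potentialE i z : chart_potential i z =
  f0 (param i z.2) - (z.1 - t0) * tavg t0 0 (chart_bernoulli i) z.
Proof.
rewrite /chart_potential /potential /tavg; congr (_ - _ * _).
by apply: eq_int01 => r _; rewrite expr0 mul1r.
Qed.

Lemma tseg_chart i z r : ((I : set R^o) `*` chart_img i) z -> 0 <= r <= 1 ->
  ((I : set R^o) `*` chart_img i) (tseg t0 r z).
Proof.
move=> [/= Iz iz] /andP[r0 r1]; split => //=.
move: z.1 Iz => a Ia.
have [le|/ltW ge] := leP t0 a.
  have h0 : 0 <= r * (a - t0) by rewrite mulr_ge0// subr_ge0.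
  have h1 : 0 <= (1 - r) * (a - t0) by rewrite mulr_ge0// subr_ge0.
  by apply: (I_interval It0 Ia); apply/andP; split; lra.
have h0 : 0 <= r * (t0 - a) by rewrite mulr_ge0// subr_ge0.
have h1 : 0 <= (1 - r) * (t0 - a) by rewrite mulr_ge0// subr_ge0.
by apply: (I_interval Ia It0); apply/andP; split; lra.
Qed.

Let smooth_time_primitive i : smooth_on ((I : set R^o) `*` chart_img i)
  (fun z : RV => (z.1 - t0) * tavg t0 0 (chart_bernoulli i) z : R^o).
Proof.
move=> k; have oE := open_spacetime I_open (@chart_img_is_open _ _ _ i).
apply: (CkM oE); last exact: (Ck_tavg oE (@tseg_chart i) 0 (@smooth_chart_bernoulli i k)).
apply: (CkB oE _ (Ck_cst _ _ (t0 : R^o))).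
by apply: (@Ck_sub _ _ _ _ setT) => //; exact: Ck_fst.
Qed.

Lemma smooth_potential : smooth_fun_on I potential.
Proof.
move=> i k; have oE := open_spacetime I_open (@chart_img_is_open _ _ _ i).
apply: (@Ck_ext _ _ _ _ _ (fun z : RV => f0 (param i z.2) -
    (z.1 - t0) * tavg t0 0 (chart_bernoulli i) z : R^o)) => //.
  by move=> z _; rewrite -chart_potentialE.
apply: (CkB oE); first exact: (Ck_snd I (f0_smooth i k)).
exact: smooth_time_primitive.
Qed.

Lemma chart_potential_dt i z : ((I : set R^o) `*` chart_img i) z ->
  'D_tdir (chart_potential i) z = - chart_bernoulli i z.
Proof.
move=> Ez; have oE := open_spacetime I_open (@chart_img_is_open _ _ _ i).
rewrite (_ : chart_potential i = fun z => f0 (param i z.2) -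
    (z.1 - t0) * tavg t0 0 (chart_bernoulli i) z : R^o); last first.
  by apply/funext => y; exact: chart_potentialE.
have f0d : is_derive z tdir (fun y : RV => f0 (param i y.2) : R^o) 0.
  have L (h : R) (x y : RV) : (h *: x + y).2 = h *: x.2 + y.2 by [].
  apply: DeriveDef.
    apply: (derivable_affine (f := f0 \o param i : _ -> R^o) L).
    by apply: (Ck_derivable (f0_smooth i 1)); case: Ez.
  by rewrite (derive_affine L (f0 \o param i : _ -> R^o)) derive0.
have bd := derive_time_primitive oE (@tseg_chart i) (@smooth_chart_bernoulli i 1) Ez.
have pd : derivable (fun y : RV => (y.1 - t0) * tavg t0 0 (chart_bernoulli i) y : R^o) z tdir.
  exact: (smooth_on_derivable (@smooth_time_primitive i) Ez).
rewrite (derive_val (is_derive := is_deriveB f0d (derivableP pd))).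
by rewrite bd sub0r.
Qed.

(** The bridge between the chart-free statement about [v t] and the defect that is propagated in
    coordinates. *)
Lemma chart_gradP i t x : I t -> chart_img i x ->
  v t i (param i x) = grad g (potential t) i (param i x) <->
  forall d, chart_covector i d (t, x) = 'D_(xdir d) (chart_potential i) (t, x).
Proof.
move=> It ix; have ip := param_dom ix.
have cE d : (v t i (param i x) *m g i (param i x)) 0 d = chart_covector i d (t, x).
  rewrite mxE; apply: eq_bigr => c _; rewrite mulrC; congr (_ * _).
  by rewrite -{1}(Defs.metric_sym g ip) mxE.
have pE d : partial i d (potential t) (param i x) =
    'D_(xdir d) (chart_potential i) (t, x).
  by rewrite partial_param// -derive_slice.
split=> [/(gradP g _ _ ip)/rowP E d|E].
  by rewrite -cE E mxE pE.
by apply/(gradP g _ _ ip)/rowP => d; rewrite cE mxE pE.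
Qed.

Hypothesis v_t0 : forall i p, dom i p -> v t0 i p = grad g f0 i p.
Hypothesis M_compact : compact [set: M].

Let is_pot t q := forall j, dom j q -> v t j q = grad g (potential t) j q.

(** Both sides transform as vector fields, so equality in one chart gives equality in all. *)
Let is_pot_chart i t q : I t -> dom i q ->
  v t i q = grad g (potential t) i q -> is_pot t q.
Proof.
move=> It iq E j jq; rewrite (v_field It iq jq) E.
by rewrite (grad_vector_field g (smooth_fun_slice It smooth_potential) iq jq).
Qed.

Let is_pot_t0 q : is_pot t0 q.
Proof.
rewrite /is_pot; have -> : potential t0 = f0.
  by apply/funext => p; rewrite /potential subrr mul0r subr0.
by move=> j; exact: v_t0.
Qed.

(** Each point of [M] has a neighbourhood on which the equality persists for some time; compactness
    of [M] yields a time span common to all points. *)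
Let is_pot_near s : I s -> (forall q, is_pot s q) ->
  \forall t \near s, forall q, is_pot t q.
Proof.
move=> Is pots; move/compact_near_coveringP: M_compact.
move=> /(_ _ (nbhs s) is_pot) H.
have {H} : \forall t \near s, [set: M] `<=` is_pot t.
  apply: H => p _; have [i ip] := atlas_cover p.
  have ipx := coord_img ip; set x := coord i p in ipx.
  have oE := open_spacetime I_open (@chart_img_is_open _ _ _ i).
  have alpha_s y d : chart_img i y ->
      chart_covector i d (s, y) = 'D_(xdir d) (chart_potential i) (s, y).
    by move=> iy; apply: (chart_gradP Is iy).1; apply: pots; exact: param_dom.
  have prop := @potential_propagates R n I (chart_img i) I_open
    (@chart_img_is_open _ _ _ i) _ _ _ (chart_potential i)
    (@smooth_velocity i) (@smooth_chart_covector i) (@smooth_chart_bernoulli i)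
    (smooth_potential i) (fun z d => @chart_momentum i z d)
    (@chart_potential_dt i) s Is alpha_s x ipx.
  have [[A B] /= [nA nB] AB] := prop.
  exists (dom i `&` coord i @^-1` B, I `&` A).
    split; apply: filterI => //=.
    - exact: (open_nbhs_nbhs (conj (@dom_open _ _ _ i) ip)).
    - by have := chart_map_continuous ip; apply.
    - exact: (open_nbhs_nbhs (conj I_open Is)).
  move=> [q t] /= [[iq Bq] [It At]]; apply: (is_pot_chart It iq).
  have := (chart_gradP It (coord_img iq)).2; rewrite (coordK iq); apply.
  by move=> d; exact: (AB (t, coord i q) (conj At Bq) d).
by apply: filterS => t H q; exact: H.
Qed.

(** At a fixed point the defect is continuous in time; were it nonzero at [t], it would be nonzero
    at nearby times, some of which have zero defect. *)
Let is_pot_closed t : I t -> closure (I `&` [set s | forall q, is_pot s q]) t ->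
  forall q, is_pot t q.
Proof.
move=> It clt q j jq.
have := (chart_gradP It (coord_img jq)).2; rewrite (coordK jq); apply => d.
have Et : ((I : set R^o) `*` chart_img j) (t, coord j q).
  by split => //; exact: coord_img.
pose beta (s : R^o) : R^o := chart_covector j d (s, coord j q) -
  'D_(xdir d) (chart_potential j) (s, coord j q).
have cbeta : {for (t : R^o), continuous beta}.
  have c : {for (t : R^o), continuous (fun s : R^o => (s, coord j q) : RV)}.
    exact: (cvg_pair cvg_id (cvg_cst (coord j q))).
  have c1 := Ck_continuous (@smooth_chart_covector j d 0) Et.
  have c2 := Ck_continuous (@smooth_derive _ _ _ _ _ (xdir d) (smooth_potential j) 0) Et.
  exact: (contB (cont_comp c c1) (cont_comp c c2)).
apply/eqP; rewrite -subr_eq0; apply/negPn/negP => beta0.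
have nbeta : \forall s \near t, beta s != 0 by exact: (cvgr_neq0 _ cbeta).
have [s [[Is pots] /=]] := clt _ nbeta.
rewrite /beta subr_eq0 => /negP; apply; apply/eqP.
apply: (chart_gradP Is (coord_img jq)).1.
by rewrite (coordK jq); exact: pots.
Qed.

(** The good times contain [t0] and are relatively open and closed in [I], which is connected. *)
Lemma grad_potential t i p : I t -> dom i p -> v t i p = grad g (potential t) i p.
Proof.
move=> It; move: t It i p.
pose B := I `&` [set s | forall q, is_pot s q].
suff BI : B = I.
  by move=> t; rewrite -{1}BI => -[_ pott] i p; exact: pott.
have /connected_intervalP cI := I_interval.
apply: cI.
- by exists t0; split => // q; exact: is_pot_t0.
- exists (interior [set s | forall q, is_pot s q]); first exact: open_interior.
  apply/seteqP; split=> s [Is pots]; split => //; last exact: interior_subset.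
  exact: is_pot_near.
- exists (closure B); first exact: closed_closure.
  apply/seteqP; split=> s; first by move=> Bs; split; [case: Bs|exact: subset_closure].
  by move=> [Is cls]; split => // q; exact: is_pot_closed.
Qed.

(** The time derivative of the potential is minus the Bernoulli function by construction; the
    squared norm of [v] in it is now that of the gradient. *)
Lemma potential_hamilton_jacobi t i p : I t -> dom i p ->
  derive1 (fun s => potential s p : R^o) t
    + 2^-1 * sqnorm g (grad g (potential t)) i p = - u t p.
Proof.
move=> It ip; have Et : ((I : set R^o) `*` chart_img i) (t, coord i p).
  by split => //; exact: coord_img.
have := derive1_time (chart_potential i) t (coord i p).
rewrite /chart_potential /= (coordK ip) => ->.
rewrite -/(chart_potential i) (chart_potential_dt Et) /chart_bernoulli /= (coordK ip).
rewrite (bernoulliE It ip) /sqnorm -(grad_potential It ip).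
by rewrite opprD addrAC addNr add0r.
Qed.

End Flow.

(** * Uniqueness of the potential and the theorem *)

Section ConstantPotential.
Context {R : realType} {n : nat} {M : oriented_manifold R n}.

(** All directional derivatives vanish in a chart, so the mean value theorem applies on a ball
    contained in the chart image. *)
Lemma partial0_locally_constant (f : M -> R) (p : M) : smooth_fun f ->
  (forall i a q, dom i q -> partial i a f q = 0) -> \forall q \near p, f q = f p.
Proof.
move=> sf f0; have [i ip] := atlas_cover p; pose x := coord i p.
pose fi : 'rV[R]_n -> R^o := f \o param i.
have oi := @chart_img_is_open _ _ _ i.
have D0 y u : chart_img i y -> 'D_u fi y = 0.
  move=> iy; rewrite (Ck_derive_rV u oi (sf i 1) iy) big1// => a _.
  by rewrite -partial_param// f0 ?mulr0//; exact: param_dom.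
have /nbhs_ballP[e /= e0 eP] : nbhs x (chart_img i).
  by apply: open_nbhs_nbhs; split => //; exact: coord_img.
have cst y : ball x e y -> fi y = fi x.
  move=> xy.
  have seg (t : R) : 0 <= t <= 1 -> chart_img i (t *: (y - x) + x).
    move=> /andP[t0 t1]; apply: eP; move: xy; rewrite -!ball_normE /= => xy.
    rewrite opprD addrCA subrr addr0 normrN normrZ (ger0_norm t0) distrC.
    by apply: le_lt_trans xy; rewrite ler_piMl.
  have [t /seg it|t /andP[/ltW t0 /ltW t1]] := @MVT_direction R _ fi (y - x) x.
    exact: (Ck_derivable (sf i 1) it).
  rewrite D0 ?subrK; last by apply: seg; rewrite t0.
  by move=> /eqP; rewrite subr_eq0 => /eqP.
have nx : nbhs p (coord i @^-1` ball x e).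
  by have := chart_map_continuous ip; apply; exact: nbhsx_ballx.
have np : nbhs p (dom i) by exact: (open_nbhs_nbhs (conj (@dom_open _ _ _ i) ip)).
near=> q; have iq : dom i q by near: q.
have xq : ball x e (coord i q) by near: q.
by have := cst _ xq; rewrite /fi /= (coordK iq) (coordK ip).
Unshelve. all: by end_near. Qed.

(** Local constancy makes the level set through [p] both open and closed. *)
Lemma partial0_constant (f : M -> R) (p q : M) : connected [set: M] ->
  smooth_fun f -> (forall i a q, dom i q -> partial i a f q = 0) -> f q = f p.
Proof.
move=> M_conn sf f0; pose B := [set q | f q = f p].
have loc q' := partial0_locally_constant q' sf f0.
suff BT : B = [set: M] by have : B q by rewrite BT.
apply: M_conn.
- by exists p.
- exists B; last by rewrite setTI.
  by rewrite openE => r Br; apply: filterS (loc r) => r' rr'; rewrite /B /= rr'.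
- exists B; last by rewrite setTI.
  move=> r clr; have [r' [Br' rr']] := clr _ (loc r).
  by rewrite /B /= -rr'.
Qed.

End ConstantPotential.

(** * Comparison of potentials *)

Section HamiltonJacobi.
Context {R : realType} {n : nat} {M : oriented_manifold R n}.
Notation RV := (R^o * 'rV[R]_n)%type.
Variables (g : riemannian_metric M) (I : set R).
Hypothesis I_open : open I.

(** The derivatives in the divergence see a neighbourhood of [p], so agreement at [p] alone would
    not do. *)
Lemma divergence_ext (X Y : chart_index M -> M -> 'rV[R]_n) i p : dom i p ->
  (forall q, dom i q -> X i q = Y i q) -> divergence g X i p = divergence g Y i p.
Proof.
move=> ip XY; rewrite /divergence; congr (_ * _); apply: eq_bigr => a _.
apply: near_eq_derive.
apply: filterS (open_nbhs_nbhs (conj (@chart_img_is_open _ _ _ i) (coord_img ip))) => y iy.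
by rewrite /= XY//; exact: param_dom.
Qed.

Lemma derive1_ext_on (f h : R -> R) t : I t -> (forall s, I s -> f s = h s) ->
  derive1 (f : R -> R^o) t = derive1 (h : R -> R^o) t.
Proof.
move=> It fh; rewrite !derive1E; apply: near_eq_derive.
by apply: filterS (open_nbhs_nbhs (conj I_open It)) => s /fh.
Qed.

Lemma hamilton_jacobi_ext (mu : probability (borel M) R)
    (dU : (M -> R) -> (M -> R)) (theta theta' rho : R -> M -> R) :
  (forall t, I t -> theta' t = theta t) ->
  hamilton_jacobi_solution mu g dU I theta rho ->
  hamilton_jacobi_solution mu g dU I theta' rho.
Proof.
move=> E [st sr eqs]; split; [|exact: sr|].
  move=> i k; apply: Ck_ext (st i k); first exact: open_spacetime I_open (@chart_img_is_open _ _ _ i).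
  by move=> z [Iz _]; rewrite E.
move=> t i p It ip; have [e1 e2] := eqs t i p It ip.
have -> : derive1 (fun s => theta' s p : R^o) t = derive1 (fun s => theta s p : R^o) t.
  by apply: derive1_ext_on => // s Is; rewrite E.
by rewrite (E t It).
Qed.

Lemma gradient_potentials_diff (theta theta' : R -> M -> R)
    (v : R -> chart_index M -> M -> 'rV[R]_n) t p q : connected [set: M] -> I t ->
  potential_on g I v theta -> potential_on g I v theta' ->
  theta t q - theta' t q = theta t p - theta' t p.
Proof.
move=> M_conn It [st vt] [st' vt'].
have s1 := smooth_fun_slice It st; have s2 := smooth_fun_slice It st'.
apply: (@partial0_constant _ _ _ (fun q => theta t q - theta' t q)) => //.
  by move=> i k; exact: (CkB (@chart_img_is_open _ _ _ i) (s1 i k) (s2 i k)).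
move=> i a r ir; have ix := coord_img ir.
have d1 := Ck_derivable (u := delta_mx 0 a) (s1 i 1) ix.
have d2 := Ck_derivable (u := delta_mx 0 a) (s2 i 1) ix.
have -> : partial i a (fun q => theta t q - theta' t q) r =
    partial i a (theta t) r - partial i a (theta' t) r by exact: deriveB d1 d2.
have /(gradP g _ _ ir)/rowP/(_ a) := vt t i r It ir.
have /(gradP g _ _ ir)/rowP/(_ a) := vt' t i r It ir.
by rewrite !mxE => -> ->; rewrite subrr.
Qed.

Lemma smooth_time_slice (f : R -> M -> R) p : smooth_fun_on I f ->
  smooth_on (I : set R^o) (fun t : R^o => f t p : R^o).
Proof.
move=> sf k; have [i ip] := atlas_cover p; pose x := coord i p.
have c : continuous (fun t : R^o => (t, x) : RV).
  by move=> t; exact: (cvg_pair cvg_id (cvg_cst x)).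
have := @Ck_affine _ _ _ _ _ _ (@time_affine R n x) k _ _ c (sf i k).
rewrite (_ : _ \o _ = fun t : R^o => f t p); last first.
  by apply/funext => t; rewrite /= /x (coordK ip).
by apply: Ck_sub => t It; split => //; exact: coord_img.
Qed.

End HamiltonJacobi.

(** One time with a gradient velocity provides a potential for all of [I]. The continuity equation
    carries over because [v] and the gradient agree on whole chart domains. *)
Lemma fluid_potential (R : realType) (n : nat) (M : oriented_manifold R n)
    (g : riemannian_metric M) (mu : probability (borel M) R)
    (dU : (M -> R) -> (M -> R)) (I : set R)
    (v : R -> chart_index M -> M -> 'rV[R]_n) (rho : R -> M -> R) (t0 : R) :
  compact [set: M] -> smooth_on_densities mu dU -> open I -> is_interval I ->
  fluid_solution mu g dU I v rho -> I t0 -> is_gradient g (v t0) ->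
  exists2 theta, potential_on g I v theta &
    hamilton_jacobi_solution mu g dU I theta rho.
Proof.
move=> Mc dUs Io Ii [vf vs sr eqs] It0 [f0 sf0 vt0].
pose u t := dU (rho t).
have us : smooth_fun_on I u by exact: dUs.
have v_eq t i p : I t -> dom i p ->
    derive1 (fun s => v s i p) t + nabla g (v t) (v t) i p + grad g (u t) i p = 0.
  by move=> It ip; have [] := eqs t i p It ip.
have sp := smooth_potential g Io vf vs us Ii It0 sf0.
have vg t i p : I t -> dom i p -> v t i p = grad g (potential g v u t0 f0 t) i p.
  exact: (grad_potential Io vf vs us v_eq Ii It0 sf0 vt0 Mc).
exists (potential g v u t0 f0).
  split; first exact: sp.
  by move=> t i p; exact: vg.
split; [exact: sp|exact: sr|move=> t i p It ip; split].
  exact: (potential_hamilton_jacobi Io vf vs us v_eq Ii It0 sf0 vt0 Mc It ip).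
have [_ <-] := eqs t i p It ip; congr (_ + _).
apply: divergence_ext => // q iq; congr (_ *: _).
by rewrite vg.
Qed.

Theorem proposition2p4 (R : realType) (n : nat) (M : oriented_manifold R n)
    (M_compact : compact [set: M]) (M_connected : connected [set: M])
    (g : riemannian_metric M) (mu : probability (borel M) R)
    (mu_volume : normalized_volume g mu)
    (U : (M -> R) -> R) (dU : (M -> R) -> (M -> R))
    (U_dU : variational_derivative mu U dU)
    (dU_smooth : smooth_on_densities mu dU)
    (I : set R) (I_open : open I) (I_interval : is_interval I)
    (v : R -> chart_index M -> M -> 'rV[R]_n) (rho : R -> M -> R)
    (v_rho_solution : fluid_solution mu g dU I v rho) :
  (* the gradient fields form an invariant set *)
  (forall t0, I t0 -> is_gradient g (v t0) ->
     forall t, I t -> is_gradient g (v t)) /\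
  (* gradient solutions satisfy the Hamilton-Jacobi equations, for a potential
     theta that is free up to an additive function of time *)
  ((forall t, I t -> is_gradient g (v t)) ->
     (exists2 theta, potential_on g I v theta &
        hamilton_jacobi_solution mu g dU I theta rho) /\
     (forall theta, potential_on g I v theta ->
        exists2 c : R -> R, smooth_on (I : set R^o) (c : R^o -> R^o) &
          hamilton_jacobi_solution mu g dU I
            (fun t p => theta t p + c t) rho)).
Proof.
have flow t0 := @fluid_potential _ _ M g mu dU I v rho t0 M_compact dU_smooth
  I_open I_interval v_rho_solution.
split=> [t0 It0 /(flow t0 It0)[theta [sth vth] _] t It|v_grad].
  by exists (theta t); [exact: smooth_fun_slice sth|move=> i p; exact: vth].
have ex : exists2 theta, potential_on g I v theta &
    hamilton_jacobi_solution mu g dU I theta rho.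
  (* An empty [I] offers no starting time; there the zero potential satisfies all conditions
     vacuously. *)
  have [I0|/set0P[t0 It0]] := eqVneq I set0; last exact: flow (v_grad t0 It0).
  have I_empty t : ~ I t by rewrite I0.
  have s0 : smooth_fun_on I (fun (_ : R) (_ : M) => 0) by move=> i k; exact: Ck_cst.
  exists (fun _ _ => 0); first by split=> // t i p /I_empty.
  by have [_ _ sr _] := v_rho_solution; split=> // t i p /I_empty.
split=> // theta' pot'; have [theta pot hj] := ex.
(* The difference of two potentials is constant in space, so its value at the base point serves as
   the function of time. *)
exists (fun t => theta t point - theta' t point).
  by move=> k; apply: CkB => //; apply: smooth_time_slice;
    [case: pot|case: pot'].
apply: (hamilton_jacobi_ext I_open _ hj) => t It; apply/funext => p.
rewrite -(gradient_potentials_diff point p M_connected It pot pot').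
by rewrite addrC subrK.
Qed.
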